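(* Let $k\ge1$, let $\alpha_1,\beta_1,\beta_2\in\mathbb{R}$ with $\alpha_1^2+\beta_1\beta_2\ne\frac14$, assume a uniform mesh of size $h$, and suppose $|\Gamma|=|\Lambda|$ (Case 2) and that $P_h^\star$ is well defined, i.e. $N$ is odd and $\Gamma=-\Lambda$ if $k$ is odd, $\Gamma=\Lambda$ if $k$ is even. Then for $p=2,\infty$ and periodic $u\in W^{k+4,\infty}(I)$, $$\|P_h^\star u-u\|_{L^p(I)}\le Ch^{k+1}\|u\|_{W^{k+4,\infty}(I)}\Bigg(1+\Big(1+\frac{\|Q_2\|_\infty}{|\Gamma|}\Big)\Big(\|V_1\|_\infty+h^{-1}\|V_2\|_\infty\Big)\Bigg).$$
   Context: Mesh: $I=[a,b]$, $a=x_{1/2}<\dots<x_{N+1/2}=b$, $I_j=(x_{j-1/2},x_{j+1/2})$, uniform with $h=(b-a)/N$. $V_h^k$ is the space of functions on $I$ whose restriction to each $I_j$ is a polynomial of degree at most $k$. At an interface, $v^\pm$ denote the limits from the right ($+$) and left ($-$) cells, with periodic identification of $x_{1/2}$ and $x_{N+1/2}$; $[v]=v^+-v^-$, $\{v\}=\frac12(v^++v^-)$; the same notation is used for the piecewise derivative $v_x$. Projection $P_h^\star$ (depending on $\alpha_1,\beta_1,\beta_2$): for a periodic function $u$, $P_h^\star u$ is the unique $w\in V_h^k$ satisfying, for all $j=1,\dots,N$, (i) $\int_{I_j}w\,v_h\,dx=\int_{I_j}u\,v_h\,dx$ for all $v_h\in P^{k-2}(I_j)$ (void if $k=1$); (ii)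 $\{w\}-\alpha_1[w]+\beta_2[w_x]=u$ at $x_{j+1/2}$; (iii) $\{w_x\}+\alpha_1[w_x]+\beta_1[w]=u_x$ at $x_{j+1/2}$. Quantities: $\Gamma=\beta_1+\frac{k^2(k^2-1)}{h^2}\beta_2-\frac{2k^2}{h}(\alpha_1^2+\beta_1\beta_2+\frac14)$, $\Lambda=-\frac{2k}{h}(\alpha_1^2+\beta_1\beta_2-\frac14)$, $c_2=\frac{2k\alpha_1}{h}$, $b_1=-\beta_1-\frac{k^2(k^2+1)}{h^2}\beta_2+\frac{2k^2}{h}(\alpha_1^2+\beta_1\beta_2+\frac14)$, $b_2=-\frac{2k^3}{h^2}\beta_2+\frac{2k}{h}(\alpha_1^2+\beta_1\beta_2+\frac14)$, $$Q_2=\begin{bmatrix}c_2&b_1+b_2\\ b_1-b_2&-c_2\end{bmatrix},\quad V_1=\frac1\Lambda\begin{bmatrix}-\beta_1+\frac{k(k+1)}{h}\big((\frac12-\alpha_1)^2+\beta_1\beta_2\big)\\ \beta_1-\frac{k(k-1)}{h}\big((\frac12-\alpha_1)^2+\beta_1\beta_2\big)\end{bmatrix},\quad V_2=\begin{bmatrix}-\frac{h}{2k}\\ \frac{h}{2k}\end{bmatrix}.$$ $\|\cdot\|_\infty$ is the max norm of vectors and the induced matrix norm. ''Periodic $u\in W^{m,\infty}(I)$'' means that the $(b-a)$-periodic extension of $u$ has this regularity; $\|u\|_{W^{m,\infty}(I)}$ is the full Sobolev norm. $C$ is a generic constant independent of $h$, of $\alpha_1,\beta_1,\beta_2$ (which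 may depend on $h$), and of $u$. *)

(* Defs.v *)
From HB Require Import structures.
From mathcomp Require Import all_boot all_order all_algebra.
From mathcomp Require Import all_classical all_reals all_analysis.

Set Implicit Arguments.
Unset Strict Implicit.
Unset Printing Implicit Defensive.

Import Order.TTheory GRing.Theory Num.Theory.
Import numFieldNormedType.Exports.

Local Open Scope classical_set_scope.
Local Open Scope ring_scope.

Definition leb (R : realType) : {measure set (measurableTypeR R) -> \bar R} :=
  lebesgue_measure.

Definition LpNorm (R : realType) (p : \bar R) (D : set R) (f : R -> R) : \bar R :=
  Lnorm (leb R) p (EFin \o (f \_ D)).

Definition test_function (R : realType) (phi : R -> R) : Prop :=
  [/\ forall x, derivable phi x 1,
      continuous (derive1 phi) &
      exists M : R, forall x, M < `|x| -> phi x = 0].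

(* Weak derivatives on the whole line, tested against C^1_c (which gives the
   same notion as C^oo_c). *)
Definition is_weak_derivative (R : realType) (f g : R -> R) : Prop :=
  forall phi : R -> R, test_function phi ->
    \int[leb R]_x (f x * derive1 phi x) = - \int[leb R]_x (g x * phi x).

(* A chosen essentially bounded weak derivative; it is unique up to a null set
   when it exists, and is the junk value 0 otherwise. *)
Definition weak_derivative (R : realType) (f : R -> R) : R -> R :=
  xget (fun=> 0)
    [set g : R -> R | g \in Lfun (leb R) +oo%E /\ is_weak_derivative f g].

Definition weak_derivativen (R : realType) (i : nat) (f : R -> R) : R -> R :=
  iter i (@weak_derivative R) f.

Definition in_Winfty (R : realType) (m : nat) (f : R -> R) : Prop :=
  (forall i, (i <= m)%N -> weak_derivativen i f \in Lfun (leb R) +oo%E) /\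
  (forall i, (i < m)%N ->
    is_weak_derivative (weak_derivativen i f) (weak_derivativen i.+1 f)).

Definition WinftyNorm (R : realType) (m : nat) (D : set R) (f : R -> R) : \bar R :=
  (\sum_(i < m.+1) LpNorm +oo D (weak_derivativen i f))%E.

(* A periodic function on [a, b] is represented by its (b - a)-periodic
   extension to the line.  Continuity selects the continuous representative of
   the Sobolev class: point values of u are used at the interfaces. *)
Definition periodic_Winfty (R : realType) (m : nat) (a b : R) (u : R -> R) : Prop :=
  [/\ forall x, u (x + (b - a)) = u x, continuous u & in_Winfty m u].

Definition mesh_size (R : realType) (a b : R) (N : nat) : R := (b - a) / N%:R.

(* mesh_node a b N i is x_{i+1/2}, for 0 <= i <= N. *)
Definition mesh_node (R : realType) (a b : R) (N i : nat) : R :=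
  a + i%:R * mesh_size a b N.

(* Cells are numbered from 0: mesh_cell a b N j is I_{j+1}. *)
Definition mesh_cell (R : realType) (a b : R) (N j : nat) : set R :=
  `]mesh_node a b N j, mesh_node a b N j.+1[.

(* Values at the nodes are left free. *)
Definition Vh (R : realType) (a b : R) (N k : nat) : set (R -> R) :=
  [set v | forall j, (j < N)%N -> exists2 q : {poly R},
     (size q <= k.+1)%N & {in mesh_cell a b N j, forall x, v x = q.[x]}].

(* Traces at x_{i+1/2} for 1 <= i <= N; the cell to the right of x_{N+1/2} is
   the first one, hence the reduction of i modulo N. *)
Definition trace_left (R : realType) (a b : R) (N : nat) (v : R -> R) (i : nat) : R :=
  lim (v x @[x --> (mesh_node a b N i)^'-]).

Definition trace_right (R : realType) (a b : R) (N : nat) (v : R -> R) (i : nat) : R :=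
  lim (v x @[x --> (mesh_node a b N (i %% N))^'+]).

Definition jump (R : realType) (a b : R) (N : nat) (v : R -> R) (i : nat) : R :=
  trace_right a b N v i - trace_left a b N v i.

Definition average (R : realType) (a b : R) (N : nat) (v : R -> R) (i : nat) : R :=
  (trace_right a b N v i + trace_left a b N v i) / 2.

(* w = P_h^* u.  Polynomials of degree at most k - 2 are those of size at most
   k - 1; for k = 1 only the zero polynomial qualifies. *)
Definition is_Phstar (R : realType) (a b : R) (N k : nat)
    (alpha1 beta1 beta2 : R) (u w : R -> R) : Prop :=
  [/\ Vh a b N k w,
      forall j, (j < N)%N -> forall q : {poly R}, (size q <= k.-1)%N ->
        \int[leb R]_(x in mesh_cell a b N j) (w x * q.[x]) =
        \int[leb R]_(x in mesh_cell a b N j) (u x * q.[x]),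
      forall j, (1 <= j <= N)%N ->
        average a b N w j - alpha1 * jump a b N w j
          + beta2 * jump a b N (derive1 w) j
        = u (mesh_node a b N j) &
      forall j, (1 <= j <= N)%N ->
        average a b N (derive1 w) j + alpha1 * jump a b N (derive1 w) j
          + beta1 * jump a b N w j
        = derive1 u (mesh_node a b N j)].

Definition Gam (R : realType) (k : nat) (h alpha1 beta1 beta2 : R) : R :=
  beta1 + (k%:R ^+ 2 * (k%:R ^+ 2 - 1)) / h ^+ 2 * beta2
  - (2 * k%:R ^+ 2) / h * (alpha1 ^+ 2 + beta1 * beta2 + 1 / 4).

Definition Lam (R : realType) (k : nat) (h alpha1 beta1 beta2 : R) : R :=
  - ((2 * k%:R) / h) * (alpha1 ^+ 2 + beta1 * beta2 - 1 / 4).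

Definition c2 (R : realType) (k : nat) (h alpha1 : R) : R :=
  (2 * k%:R * alpha1) / h.

Definition b1 (R : realType) (k : nat) (h alpha1 beta1 beta2 : R) : R :=
  - beta1 - (k%:R ^+ 2 * (k%:R ^+ 2 + 1)) / h ^+ 2 * beta2
  + (2 * k%:R ^+ 2) / h * (alpha1 ^+ 2 + beta1 * beta2 + 1 / 4).

Definition b2 (R : realType) (k : nat) (h alpha1 beta1 beta2 : R) : R :=
  - ((2 * k%:R ^+ 3) / h ^+ 2) * beta2
  + (2 * k%:R) / h * (alpha1 ^+ 2 + beta1 * beta2 + 1 / 4).

Definition mx_of_rows (R : realType) (m n : nat) (s : seq (seq R)) : 'M[R]_(m, n) :=
  \matrix_(i < m, j < n) (nth [::] s i)`_j.

Definition Q2 (R : realType) (k : nat) (h alpha1 beta1 beta2 : R) : 'M[R]_2 :=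
  let c := c2 k h alpha1 in
  let d := b1 k h alpha1 beta1 beta2 in
  let e := b2 k h alpha1 beta1 beta2 in
  mx_of_rows 2 2 [:: [:: c    ; d + e];
                     [:: d - e; - c  ]].

Definition V1 (R : realType) (k : nat) (h alpha1 beta1 beta2 : R) : 'cV[R]_2 :=
  let B := (1 / 2 - alpha1) ^+ 2 + beta1 * beta2 in
  (Lam k h alpha1 beta1 beta2)^-1 *:
  mx_of_rows 2 1 [:: [:: - beta1 + (k%:R * (k%:R + 1)) / h * B];
                     [:: beta1 - (k%:R * (k%:R - 1)) / h * B]].

Definition V2 (R : realType) (k : nat) (h : R) : 'cV[R]_2 :=
  mx_of_rows 2 1 [:: [:: - (h / (2 * k%:R))];
                     [:: h / (2 * k%:R)]].

(* `|x| is the max norm on 'cV[R]_n, but the library's `|A| on 'M[R]_n is the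
   largest entry, not the induced norm; hence this definition. *)
Definition induced_norm (R : realType) (n : nat) (A : 'M[R]_n) : R :=
  sup [set `|A *m x| | x in [set x : 'cV[R]_n | `|x| <= 1]].

(* Main.v *)
Require Import Defs.
From HB Require Import structures.
From mathcomp Require Import all_boot all_order all_algebra.
From mathcomp Require Import all_classical all_reals all_analysis.
From mathcomp Require Import measurable_realfun ess_sup_inf hoelder.
From mathcomp Require Import ring lra.

Set Implicit Arguments.
Unset Strict Implicit.
Unset Printing Implicit Defensive.

Import Order.TTheory GRing.Theory Num.Theory.
Import numFieldNormedType.Exports.

Local Open Scope classical_set_scope.
Local Open Scope ring_scope.

(* Compare P_h^* u with a local projection that keeps the moments, the value at
   the right end and the slope at the left end of each cell.  On cell j the two
   differ by a combination of the Legendre polynomials L_{k-1} and L_k; in Case 2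
   the interface conditions give its coefficients c_j the recursion
     c_j + (1 + Q2 / Gamma) c_{j+1} = X_{j+1} V1 + (2 / h) Y_j V2,
   where X, Y are the endpoint errors of the local projection.  Since
   Q2 ^ 2 = 0, the adjugate turns this into (1 + T)^2 c = G with T the shift.  As
   N is odd, inverting each factor 1 + T on periodic sequences costs only one
   difference of G times N = (b - a) / h, and every difference of X and Y gains
   a factor h because the local projection commutes with translations. *)

(** Order [k + 4] is the price of two differences: the local projection error is governed by
    derivative [k + 1], the second differences of X and Y by derivative [k + 3], and one more
    bounded weak derivative makes that one continuous. Weak derivatives are known only almost
    everywhere and through an arbitrary choice, so they are first replaced by classical ones, by
    comparison with primitives at Lebesgue points; this also gives a meaning to the pointwise slope
    of [u] in the interface conditions. The local projection does not involve the flux parameters,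
    hence neither do its constants. Keeping the value on the right and the slope on the left leaves
    one error of each kind per interface: X from the right cell, Y from the left cell. [Q2] is
    trace-free and its square is [Gamma ^ 2 - Lambda ^ 2] times the identity, which vanishes in Case
    2. The inverse of (1 + T)^2 has norm of order N^2, so a bound that ignores the smoothness of G
    would lose two powers of h. *)

(** * Quadratic-spline test functions and integrals over segments *)

Lemma is_derive_of_quadratic (R : realType) (f : R -> R) (x d C : R) :
  (forall h, `|f (x + h) - f x - h * d| <= C * h ^+ 2) -> is_derive x 1 f d.
Proof.
move=> H.
have C0 : 0 <= C by have := H 1; rewrite expr1n mulr1; apply: le_trans.
have cv : h^-1 *: (f (h *: (1 : R^o) + x) - f x) @[h --> 0^'] --> d.
  apply/cvgrPdist_le => e e0; near=> h.
  have h0 : h != 0 by near: h; exact: nbhs_dnbhs_neq.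
  have -> : h *: (1 : R^o) = h by rewrite /GRing.scale /= mulr1.
  rewrite /GRing.scale /=.
  have -> : d - h^-1 * (f (h + x) - f x) = - (h^-1 * (f (x + h) - f x - h * d)).
    by rewrite (addrC h x); field.
  rewrite normrN normrM normfV ler_pdivrMl ?normr_gt0//.
  apply: (le_trans (H h)).
  have -> : C * h ^+ 2 = `|h| * (C * `|h|) by rewrite -real_normK ?num_real// ; ring.
  rewrite ler_pM2l ?normr_gt0//.
  have : `|h| <= e / (C + 1).
    near: h; apply: dnbhs0_le; rewrite divr_gt0//; lra.
  rewrite ler_pdivlMr; last lra.
  by apply: le_trans; rewrite mulrC ler_wpM2l//; lra.
apply: DeriveDef; first by apply/cvg_ex; exists d.
by apply: cvg_lim.
Unshelve. all: by end_near. Qed.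

(** The primitive of the positive part: C^1 with an explicit derivative, so that C^1 test functions
    can be assembled from it without smooth cut-offs. *)
Definition posq (R : realType) (t : R) : R := Num.max t 0 ^+ 2 / 2.

Lemma is_derive_posq (R : realType) (x : R) :
  is_derive x 1 (@posq R) (Num.max x 0).
Proof.
apply: (@is_derive_of_quadratic _ _ _ _ 1) => h; rewrite /posq ler_norml.
by apply/andP; split; case: (leP x 0); case: (leP (x + h) 0); nra.
Qed.

(** A second difference of [posq]: a C^1 spline rising from 0 at -1 to 1 at 1. Its derivative [tent]
    is the hat function [max (1 - |t|) 0], of integral one. *)
Definition step (R : realType) (t : R) : R :=
  posq (t + 1) - 2 * posq t + posq (t - 1).

Definition tent (R : realType) (t : R) : R :=
  Num.max (t + 1) 0 - 2 * Num.max t 0 + Num.max (t - 1) 0.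

Lemma step_tent_bounds (R : realType) (t : R) :
  [/\ 0 <= step t <= 1, t <= -1 -> step t = 0, 1 <= t -> step t = 1,
      0 <= tent t <= 1 & 1 <= `|t| -> tent t = 0].
Proof.
rewrite /step /tent /posq.
have e : (1 <= `|t|) = (t <= -1) || (1 <= t).
  by rewrite ler_normr orbC; congr orb; apply/idP/idP => ?; lra.
rewrite e; case: (leP (t + 1) 0) => ?; case: (leP t 0) => ?; case: (leP (t - 1) 0) => ?;
 (split; [ apply/andP; split; nra | move=> ?; nra | move=> ?; nra | apply/andP; split;
     lra | case/orP => ?; lra]).
Qed.

Lemma is_derive_step_scaled (R : realType) (x d t : R) : 0 < d ->
  is_derive t 1 (fun t => step ((t - x) / d)) (tent ((t - x) / d) / d).
Proof.
move=> d0.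
have A (c : R) : is_derive t 1 (fun t => posq ((t - x) / d + c))
    (Num.max ((t - x) / d + c) 0 / d).
  have -> : (fun t => posq ((t - x) / d + c)) = @posq R \o (fun t => (t - x) / d + c) by [].
  apply: is_derive1_comp; first exact: is_derive_posq.
  apply: is_derive_eq; rewrite /GRing.scale /=; ring.
rewrite (_ : (fun t => step _) = (fun t => posq ((t - x) / d + 1) - 2 * posq
    ((t - x) / d + 0) + posq ((t - x) / d - 1))); last first.
  by apply/funext => s; rewrite /step addr0.
have A1 := A 1; have A0 := A 0; have A2 := A (- 1).
apply: is_derive_eq.
rewrite /tent /GRing.scale /= addr0; ring.
Qed.

Lemma continuous_tent (R : realType) : continuous (@tent R).
Proof.
have A (c : R) : continuous (fun t : R => Num.max (t + c) 0).
  move=> t; have -> : (fun t : R => Num.max (t + c) 0) = (fun t => t + c) \max cst 0 by [].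
  apply: continuous_max; last exact: cst_continuous.
  by apply: cvgD; [exact: cvg_id|exact: cvg_cst].
move=> t; rewrite /tent; apply: cvgD; last exact: (A (- 1)).
apply: cvgB; first exact: A.
apply: cvgM; first exact: cvg_cst.
by have := A 0 t; rewrite /continuous_at addr0; under eq_fun do rewrite addr0.
Qed.

Lemma continuous_tent_scaled (R : realType) (x d : R) :
  continuous (fun t => tent ((t - x) / d) / d).
Proof.
move=> t; apply: cvgM; last exact: cvg_cst.
apply: (@continuous_comp _ _ _ (fun t => (t - x) / d) (@tent R));
    last exact: continuous_tent.
by apply: cvgM; [apply: cvgB; [exact: cvg_id|exact: cvg_cst]|exact: cvg_cst].
Qed.

Lemma is_derive_continuous (R : realType) (f : R -> R) (x d : R) :
  is_derive x 1 f d -> {for x, continuous f}.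
Proof. by case=> /derivable1_diffP/differentiable_continuous. Qed.

Lemma Rintegral_FTC (R : realType) (F f : R -> R) (c d : R) : c < d ->
  continuous f -> (forall x : R, is_derive x 1 F (f x)) ->
  \int[leb R]_(x in `[c, d]) f x = F d - F c.
Proof.
move=> cd cf dF; rewrite /Rintegral (@continuous_FTC2 _ _ F) //.
- exact: continuous_subspaceT.
- split.
  + by move=> t _; have [] := dF t.
  + apply: cvg_at_right_filter; exact: (is_derive_continuous (dF c)).
  + apply: cvg_at_left_filter; exact: (is_derive_continuous (dF d)).
- by move=> t _; rewrite derive1E (@derive_val _ _ _ _ _ _ _ (dF t)).
Qed.

Lemma continuous_segment_integrable (R : realType) (f : R -> R) (c d : R) :
  continuous f -> (leb R).-integrable `[c, d] (EFin \o f).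
Proof.
move=> cf; apply: continuous_compact_integrable; first exact: segment_compact.
exact: continuous_subspaceT.
Qed.


Lemma segment_integrable (R : realType) (f : R -> R) (c d K : R) :
  measurable_fun [set: measurableTypeR R] f -> (forall x, `|f x| <= K) ->
  (leb R).-integrable `[c, d] (EFin \o f).
Proof.
move=> mf fK; apply: measurable_bounded_integrable => //.
- rewrite /= /leb lebesgue_measure_itv /=; case: ifP => // _.
  by rewrite -EFinD ltry.
- exact: measurable_funTS.
- exists K; split; first exact: num_real.
  by move=> x Kx y _ /=; apply: (le_trans (fK y)); exact: ltW.
Qed.

Lemma Rintegral_indicE (R : realType) (f : R -> R) (c d : R) :
  \int[leb R]_x (f x * (c <= x <= d)%R%:R) = \int[leb R]_(x in `[c, d]) f x.
Proof.
rewrite [RHS]Rintegral_mkcond; apply: eq_Rintegral => x _.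
rewrite patchE mem_setE in_itv /=.
by case: ifP; rewrite ?mulr1 ?mulr0.
Qed.

Lemma indic_integrable (R : realType) (f : R -> R) (c d K : R) :
  measurable_fun [set: measurableTypeR R] f -> (forall x, `|f x| <= K) ->
  (leb R).-integrable setT (EFin \o (fun x => f x * (c <= x <= d)%R%:R)).
Proof.
move=> mf fK; have := segment_integrable c d mf fK.
rewrite integrable_mkcond // restrict_EFin; congr ((leb R).-integrable _ (_ \o _)).
apply/funext => x; rewrite patchE mem_setE in_itv /=.
by case: ifP; rewrite ?mulr1 ?mulr0.
Qed.

Lemma Rintegral_segment_le (R : realType) (f : R -> R) (c d K : R) : c <= d ->
  (leb R).-integrable `[c, d] (EFin \o f) ->
  (forall x, c <= x <= d -> `|f x| <= K) ->
  `|\int[leb R]_(x in `[c, d]) f x| <= K * (d - c).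
Proof.
move=> cd intf fK; apply: le_trans; first exact: le_normr_Rintegral.
have -> : K * (d - c) = \int[leb R]_(x in `[c, d]) K.
  rewrite Rintegral_cst //= /leb lebesgue_measure_itv /= lte_fin.
  case: ltP => //= dc; congr (_ * _); apply/eqP; rewrite eq_le; lra.
apply: le_Rintegral => //.
- exact: integrable_norm.
- by apply: (@segment_integrable _ (cst K) c d `|K|) => //.
Qed.

(** The kernel has integral one, is at most [d^-1] and lives on an interval of length [2 * d]; hence
    the error is at most [d^-1] times the integral of [|f - f x|], which is twice its average over
    the ball. *)
Lemma tent_mollify_le (R : realType) (f : R -> R) (x d M : R) : 0 < d ->
  measurable_fun [set: measurableTypeR R] f -> (forall x, `|f x| <= M) ->
  `|\int[leb R]_t (f t * (tent ((t - x) / d) / d)) - f x| <= 2 * fine (davg f x d).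
Proof.
move=> d0 mf fM.
have mtent : measurable_fun [set: measurableTypeR R] (fun t => tent ((t - x) / d) / d).
  by apply: continuous_measurable_fun; exact: continuous_tent_scaled.
have tb t : 0 <= tent ((t - x) / d) / d <= d^-1.
  have [_ _ _ /andP[? ?] _] := step_tent_bounds ((t - x) / d).
  have di : 0 <= d^-1 by rewrite invr_ge0 ltW.
  by apply/andP; split; [exact: mulr_ge0|exact: ler_piMl].
have tabs t : `|tent ((t - x) / d) / d| <= d^-1.
  by have /andP[? ?] := tb t; rewrite ger0_norm.
have t0 t : ~~ (x - d <= t <= x + d)%R -> tent ((t - x) / d) / d = 0.
  move=> nt; have [_ _ _ _ ->] := step_tent_bounds ((t - x) / d); first by rewrite mul0r.
  rewrite normrM normfV (gtr0_norm d0) ler_pdivlMr // mul1r ler_normr.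
  by move: nt; rewrite negb_and -!ltNge => /orP[] ?; apply/orP; [right|left]; lra.
have I1 : \int[leb R]_(t in `[x - d, x + d]) (tent ((t - x) / d) / d) = 1.
  have xd : x - d < x + d by lra.
  rewrite (Rintegral_FTC xd (@continuous_tent_scaled _ x d)
    (fun t => is_derive_step_scaled x t d0)).
  have -> : (x + d - x) / d = 1 by field; lra.
  have -> : (x - d - x) / d = -1 by field; lra.
  have [_ _ H1 _ _] := step_tent_bounds (1 : R).
  have [_ H0 _ _ _] := step_tent_bounds (-1 : R).
  by rewrite H1 // H0 // subr0.
have mul_le (F : R -> R) K t : `|F t| <= K -> `|F t * (tent ((t - x) / d) / d)| <= K * d^-1.
  by move=> ?; rewrite normrM ler_pM.
have -> : \int[leb R]_t (f t * (tent ((t - x) / d) / d)) =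
    \int[leb R]_(t in `[x - d, x + d]) (f t * (tent ((t - x) / d) / d)).
  rewrite -Rintegral_indicE; apply: eq_Rintegral => t _.
  by case: (boolP (x - d <= t <= x + d)) => /= H; rewrite ?mulr1 // t0 // mulr0 mul0r.
have mft : measurable_fun [set: measurableTypeR R]
    (fun t => f t * (tent ((t - x) / d) / d)).
  exact: measurable_funM.
have mfc : measurable_fun [set: measurableTypeR R] (fun t => f t - f x).
  exact: measurable_funB.
have -> : f x = \int[leb R]_(t in `[x - d, x + d]) (f x * (tent ((t - x) / d) / d)).
  rewrite RintegralZl // ?I1 ?mulr1 //.
  exact: (segment_integrable _ _ mtent tabs).
rewrite -RintegralB //; first last.
- apply: (@segment_integrable _ _ _ _ (`|f x| * d^-1)).
    by apply: measurable_funM.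
  by move=> t; exact: (mul_le (cst (f x))).
- by apply: (@segment_integrable _ _ _ _ (M * d^-1)) => // t; exact: mul_le.
have fMx t : `|f t - f x| <= M + M by apply: (le_trans (ler_normB _ _)); exact: lerD.
have i2 : (leb R).-integrable `[x - d, x + d]
    (EFin \o (fun t => (f t - f x) * (tent ((t - x) / d) / d))).
  apply: (@segment_integrable _ _ _ _ ((M + M) * d^-1)).
    exact: measurable_funM.
  by move=> t; exact: (mul_le (fun t => f t - f x)).
under eq_Rintegral do rewrite -mulrBl.
apply: le_trans; first exact: le_normr_Rintegral.
have i3 : (leb R).-integrable `[x - d, x + d] (EFin \o (fun t => `|f t - f x|)).
  apply: (@segment_integrable _ _ _ _ (M + M)).
    exact: measurableT_comp.
  by move=> t; rewrite normr_id.
apply: (@le_trans _ _ (\int[leb R]_(t in `[x - d, x + d]) (d^-1 * `|f t - f x|))).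
  apply: le_Rintegral => //.
  - exact: integrable_norm.
  - apply: (@segment_integrable _ _ _ _ (d^-1 * (M + M))).
      apply: measurable_funM => //; exact: measurableT_comp.
    by move=> t; rewrite normrM normr_id normfV (gtr0_norm d0) ler_wpM2l // invr_ge0 ltW.
  - by move=> t _; rewrite normrM mulrC ler_wpM2r.
rewrite RintegralZl //.
rewrite /davg /iavg (lebesgue_measure_ball _ (ltW d0)) inver mulrn_eq0 /= gt_eqF //=.
have -> : (\int[lebesgue_measure]_(y in ball x d) `|((center (f x) \o f) y)%:E|)%E =
   (\int[lebesgue_measure]_(t in `[(x - d)%R, (x + d)%R]) (`|f t - f x|%R)%:E)%E.
  rewrite ball_itv [RHS]integral_itv_bndoo //.
  apply/measurable_EFinP; apply: measurable_funTS; exact: measurableT_comp.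
rewrite fineM //; last by apply: integrable_fin_num.
rewrite /= mulrA le_eqVlt; apply/orP; left; apply/eqP; congr (_ * _).
by rewrite -[d *+ 2]mulr_natl; field; lra.
Qed.

(* Test functions: C^1 approximations of the indicator of [x, y].  At Lebesgue
   points their derivatives integrate to approximate point evaluations. *)
Definition bump (R : realType) (x y d t : R) : R :=
  step ((t - x) / d) - step ((t - y) / d).

Lemma is_derive_bump (R : realType) (x y d t : R) : 0 < d ->
  is_derive t 1 (bump x y d) (tent ((t - x) / d) / d - tent ((t - y) / d) / d).
Proof.
move=> d0; have ? := is_derive_step_scaled x t d0.
by have ? := is_derive_step_scaled y t d0; apply: is_deriveB.
Qed.

(** Each smoothed step differs from the jump it replaces only in a window of radius [d], and there
    by at most one. Far from [[x, y]] both windows and the indicator vanish, so the bound also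
    locates the support of [bump]. *)
Lemma bump_indic_le (R : realType) (x y d t : R) : 0 < d -> x <= y ->
  `|bump x y d t - (x <= t <= y)%R%:R|
    <= (x - d <= t <= x + d)%R%:R + (y - d <= t <= y + d)%R%:R.
Proof.
move=> d0 xy.
(* The value of the jump at [z] itself is left open, so that both [x <= t] and [y < t] are
   covered. *)
have half z (c : bool) : (z < t -> c) -> (t < z -> ~~ c) ->
    `|step ((t - z) / d) - c%:R| <= (z - d <= t <= z + d)%R%:R.
  move=> c1 c0; have [/andP[s0 s1] sL sR _ _] := step_tent_bounds ((t - z) / d).
  case: (leP (z - d) t) => tz /=; last first.
    rewrite sL; last by rewrite ler_pdivrMr //; lra.
    have -> : c = false by apply/negbTE/c0; lra.
    by rewrite subrr normr0.
  case: (leP t (z + d)) => zt /=; last first.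
    rewrite sR; last by rewrite ler_pdivlMr //; lra.
    have -> : c = true by apply: c1; lra.
    by rewrite subrr normr0.
  by rewrite ler_norml; case: c {c0 c1} => /=; lra.
have -> : bump x y d t - (x <= t <= y)%R%:R
    = (step ((t - x) / d) - (x <= t)%R%:R) - (step ((t - y) / d) - (y < t)%R%:R).
  have -> : (x <= t <= y)%R%:R = (x <= t)%R%:R - (y < t)%R%:R :> R.
    by case: (leP x t) => ?; case: (leP t y) => ? /=; rewrite ?subr0 ?subrr //; lra.
  by rewrite /bump; ring.
apply: le_trans (ler_normB _ _) _; apply: lerD; apply: half.
- exact: ltW.
- by rewrite -ltNge.
- by [].
- by move=> ty; rewrite -leNgt ltW.
Qed.

Lemma test_function_bump (R : realType) (x y d : R) : 0 < d -> x <= y ->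
  test_function (bump x y d) /\
  derive1 (bump x y d) = (fun t => tent ((t - x) / d) / d - tent ((t - y) / d) / d).
Proof.
move=> d0 xy.
have dE : derive1 (bump x y d) = (fun t => tent ((t - x) / d) / d - tent ((t - y) / d) / d).
  apply/funext => t; have ? := is_derive_bump x y t d0.
  by rewrite derive1E derive_val.
split; last exact: dE.
split.
- by move=> t; have [] := is_derive_bump x y t d0.
- by rewrite dE => t; apply: cvgB; exact: continuous_tent_scaled.
- exists (`|x| + `|y| + d) => t tM.
  (* Beyond this radius the sign of [t] alone decides on which side of [x] and of [y] it lies. *)
  have out z : `|z| <= `|x| + `|y| ->
      ((z <= t) = (0 < t)) /\ ((z - d <= t <= z + d) = false).
    move=> zM; have [z1 z2] : - (`|x| + `|y|) <= z /\ z <= `|x| + `|y|.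
      by apply/andP; rewrite -ler_norml.
    case: (ltP 0 t) => t0.
      have tE : `|t| = t by rewrite gtr0_norm.
      by split; [lra|apply/negbTE; rewrite negb_and -!ltNge; apply/orP; right; lra].
    have tE : `|t| = - t by rewrite ler0_norm.
    split; first by apply/negbTE; rewrite -ltNge; lra.
    by apply/negbTE; rewrite negb_and -!ltNge; apply/orP; left; lra.
  have [xt xd] := out x (ler_wpDr (normr_ge0 y) (lexx _)).
  have [yt yd] := out y (ler_wpDl (normr_ge0 x) (lexx _)).
  have ty : (t <= y) = ~~ (0 < t) || (t == y) by rewrite -yt -ltNge orbC -le_eqVlt.
  have tNy : (t == y) = false.
    by apply/negbTE/negP => /eqP e; move: yd; rewrite e; move/negbT/negP; apply;
        apply/andP; split; lra.
  have := bump_indic_le t d0 xy.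
  rewrite xd yd xt ty tNy orbF andbN subr0 addr0 normr_le0.
  by move/eqP.
Qed.

(** * From weak derivatives to continuous representatives *)

(** Test against [bump x y d]: its derivative is a hat at [x] minus a hat at [y], so the left side
    is close to [f x - f y] at Lebesgue points, while the right side is close to minus the integral
    of [g] over [[x, y]]. *)
Lemma weak_derivative_ftc (R : realType) (f g : R -> R) (M x y : R) :
  measurable_fun [set: measurableTypeR R] f ->
  measurable_fun [set: measurableTypeR R] g ->
  (forall x, `|f x| <= M) -> (forall x, `|g x| <= M) ->
  is_weak_derivative f g -> x <= y -> lebesgue_pt f x -> lebesgue_pt f y ->
  f y - f x = \int[leb R]_(t in `[x, y]) g t.
Proof.
move=> mf mg fM gM fg xy lx ly.
have M0 : 0 <= M by exact: le_trans (fM 0).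
apply/eqP; rewrite -subr_eq0 -normr_le0; apply/ler_addgt0Pr => e e0; rewrite add0r.
(* Error budget: each of the two mollifications costs [2 * (e / 8)], and replacing the bump by the
   indicator costs [4 * M * d], kept below [e / 2]. *)
have near_davg z : lebesgue_pt f z -> \forall d \near (0 : R)^'+, fine (davg f z d) <= e /
    8.
  move=> /fine_cvgP[_]; rewrite /= => /cvgr0_norm_le /(_ (e / 8)) H.
  have e8 : 0 < e / 8 by lra.
  apply: filterS (H e8) => d /=; exact: le_trans (ler_norm _).
near (0 : R)^'+ => d.
have d0 : 0 < d by near: d; exact: nbhs_right_gt.
have hx : fine (davg f x d) <= e / 8 by near: d; exact: near_davg.
have hy : fine (davg f y d) <= e / 8 by near: d; exact: near_davg.
have hd : 4 * M * d <= e / 2.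
  have : d <= e / (8 * (M + 1)).
    by near: d; apply: nbhs_right_le; rewrite divr_gt0 //; lra.
  rewrite ler_pdivlMr; last lra.
  nra.
have [tf dE] := test_function_bump d0 xy.
have := fg _ tf; rewrite dE.
have mT z : measurable_fun [set: measurableTypeR R] (fun t => tent ((t - z) / d) / d).
  by apply: continuous_measurable_fun; exact: continuous_tent_scaled.
have tb z t : `|tent ((t - z) / d) / d| <= d^-1.
  have [_ _ _ /andP[? ?] _] := step_tent_bounds ((t - z) / d).
  have di : 0 <= d^-1 by rewrite invr_ge0 ltW.
  by rewrite ger0_norm; [exact: ler_piMl|exact: mulr_ge0].
have iT z : (leb R).-integrable setT (EFin \o (fun t => f t * (tent ((t - z) / d) / d))).
  have := @indic_integrable _ (fun t => f t * (tent ((t - z) / d) / d)) (z - d) (z + d)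
      (M * d^-1).
  move=> /(_ (measurable_funM mf (mT z))).
  have bd t : `|f t * (tent ((t - z) / d) / d)| <= M * d^-1.
    by rewrite normrM ler_pM.
  move=> /(_ bd); congr ((leb R).-integrable _ (_ \o _)); apply/funext => t.
  case: (boolP (z - d <= t <= z + d)) => /= H; first by rewrite mulr1.
  have [_ _ _ _ ->] := step_tent_bounds ((t - z) / d); first by rewrite mul0r !mulr0.
  rewrite normrM normfV (gtr0_norm d0) ler_pdivlMr // mul1r ler_normr.
  by move: H; rewrite negb_and -!ltNge => /orP[] ?; apply/orP; [right|left]; lra.
under eq_Rintegral do rewrite mulrBr.
rewrite RintegralB //.
have mb : measurable_fun [set: measurableTypeR R] (bump x y d).
  apply: continuous_measurable_fun => t.
  exact: (is_derive_continuous (is_derive_bump x y t d0)).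
have Ax := tent_mollify_le x d0 mf fM.
have Ay := tent_mollify_le y d0 mf fM.
set ax := \int[leb R]_t _ in Ax *; set ay := \int[leb R]_t _ in Ay *.
set G := \int[leb R]_x _ => HG.
(* Two windows of length [2 * d], on each of which the integrand is off by at most [M]. *)
have HB : `|G - \int[leb R]_(t in `[x, y]) g t| <= 4 * M * d.
  rewrite /G -Rintegral_indicE.
  have i1 c1 d1 (F : R -> R) : measurable_fun [set: measurableTypeR R] F ->
      (forall x, `|F x| <= M) ->
      (leb R).-integrable setT (EFin \o (fun t => F t * (c1 <= t <= d1)%R%:R)).
    by move=> mF FM; exact: (indic_integrable _ _ mF FM).
  have b1 t : `|bump x y d t| <= 1.
    rewrite /bump.
    have [/andP[A1 A2] _ _ _ _] := step_tent_bounds ((t - x) / d).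
    have [/andP[B1 B2] _ _ _ _] := step_tent_bounds ((t - y) / d).
    by rewrite ler_norml; lra.
  have i2 : (leb R).-integrable setT (EFin \o (fun t => g t * bump x y d t)).
    have := @indic_integrable _ (fun t => g t * bump x y d t) (x - d) (y + d) M.
    move=> /(_ (measurable_funM mg mb)).
    have bd t : `|g t * bump x y d t| <= M by rewrite normrM -[M]mulr1 ler_pM.
    move=> /(_ bd); congr ((leb R).-integrable _ (_ \o _)); apply/funext => t.
    case: (boolP (x - d <= t <= y + d)) => /= H; first by rewrite mulr1.
    suff -> : bump x y d t = 0 by rewrite !mulr0.
    have := bump_indic_le t d0 xy; move: H; rewrite negb_and -!ltNge => /orP H.
    have -> : (x <= t <= y) = false by apply/negbTE; rewrite negb_and -!ltNge; apply/orP;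
        case: H => H; [left|right]; lra.
    have -> : (x - d <= t <= x + d) = false by apply/negbTE; rewrite negb_and -!ltNge;
        apply/orP; case: H => H; [left|right]; lra.
    have -> : (y - d <= t <= y + d) = false by apply/negbTE; rewrite negb_and -!ltNge;
        apply/orP; case: H => H; [left|right]; lra.
    by rewrite subr0 addr0 normr_le0 => /eqP.
  rewrite -RintegralB //; last exact: i1.
  apply: le_trans; first apply: le_normr_Rintegral => //.
    by have := integrableB measurableT i2 (i1 x y g mg gM).
  have mcM : measurable_fun [set: measurableTypeR R] (cst M) by exact: measurable_cst.
  have cM (t : R) : `|cst M t| <= M by rewrite /= ger0_norm.
  apply: (@le_trans _ _ (\int[leb R]_t
      (cst M t * (x - d <= t <= x + d)%R%:R + cst M t * (y - d <= t <= y + d)%R%:R))).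
    apply: le_Rintegral => //.
    - apply: integrable_norm; exact: (integrableB measurableT i2 (i1 x y g mg gM)).
    - exact: (integrableD measurableT (i1 (x - d) (x + d) _ mcM cM)
          (i1 (y - d) (y + d) _ mcM cM)).
    - by move=> t _; rewrite -mulrBr normrM -mulrDr ler_pM // bump_indic_le.
  rewrite RintegralD //; [|exact: i1|exact: i1].
  rewrite !Rintegral_indicE.
  have I z : `|\int[leb R]_(t in `[z - d, z + d]) cst M t| <= M * (z + d - (z - d)).
    apply: Rintegral_segment_le => //; first lra.
    exact: segment_integrable mcM cM.
  have := I x; have := I y; have := ler_norm (\int[leb R]_(t in `[x - d, x + d]) cst M t).
  have := ler_norm (\int[leb R]_(t in `[y - d, y + d]) cst M t).
  move=> *; nra.
move: HB Ax Ay; rewrite !ler_norml => /andP[? ?] /andP[? ?] /andP[? ?].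
by apply/andP; split; lra.
Unshelve. all: by end_near. Qed.

Lemma leb_setT_gt0 (R : realType) : (0 < leb R [set: measurableTypeR R])%E.
Proof.
have : (0 < leb R `[0%R, 1%R]%classic)%E.
  by rewrite /= /leb lebesgue_measure_itv /= lte_fin ltr01 -EFinD lte_fin subr0.
move=> /lt_le_trans; apply; apply: le_measure; rewrite ?inE //.
Qed.

(** Clipping at an essential bound turns it into a bound that holds everywhere, the form that
    [segment_integrable] and the mollification estimates ask for. *)
Lemma Lfun_oo_bounded (R : realType) (f : R -> R) : f \in Lfun (leb R) +oo%E ->
  measurable_fun [set: measurableTypeR R] f /\
  exists M (f' : R -> R), [/\ measurable_fun [set: measurableTypeR R] f',
    forall x, `|f' x| <= M & {ae leb R, forall x, f x = f' x}].
Proof.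
move=> /andP[]; rewrite !inE /= => mf fin; split => //.
have fin' : (Lnorm (leb R) +oo (EFin \o f) < +oo)%E by [].
move: fin'; rewrite unlock /=; have -> : (0 < leb R [set: measurableTypeR R])%E.
  exact: leb_setT_gt0.
move=> /ess_supr_bounded[M HM].
exists `|M|, (fun x => Num.max (- `|M|) (Num.min (f x) `|M|)); split.
- apply: measurable_maxr => //; apply: measurable_minr => //.
- move=> x; rewrite ler_norml; have := normr_ge0 M.
  by move=> ?; rewrite le_max lexx ge_max ge_min lexx orbT andbT /=; lra.
- apply: (@filterS _ _ (ae_filter_ringOfSetsType (leb R)) _ _ _ HM) => x /= H; have {}H :=
      le_trans H (ler_norm M).
  move: H; rewrite ler_norml => /andP[H1 H2].
  by rewrite min_l // max_r.
Qed.

Lemma is_weak_derivative_ae (R : realType) (f f' g g' : R -> R) :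
  measurable_fun [set: measurableTypeR R] f ->
  measurable_fun [set: measurableTypeR R] f' ->
  measurable_fun [set: measurableTypeR R] g ->
  measurable_fun [set: measurableTypeR R] g' ->
  {ae leb R, forall x, f x = f' x} -> {ae leb R, forall x, g x = g' x} ->
  is_weak_derivative f g -> is_weak_derivative f' g'.
Proof.
move=> mf mf' mg mg' ff gg fg phi tphi.
have [d1 d2 _] := tphi.
have mphi : measurable_fun [set: measurableTypeR R] phi.
  apply: continuous_measurable_fun => x.
  exact: differentiable_continuous (proj1 (derivable1_diffP _ _) (d1 x)).
have mphi' : measurable_fun [set: measurableTypeR R] (derive1 phi).
  exact: continuous_measurable_fun.
have E (p q r : R -> R) : measurable_fun [set: measurableTypeR R] p ->
    measurable_fun [set: measurableTypeR R] q ->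
    measurable_fun [set: measurableTypeR R] r ->
    {ae leb R, forall x, p x = q x} ->
    \int[leb R]_x (p x * r x) = \int[leb R]_x (q x * r x).
  move=> mp mq mr pq; congr fine; apply: ae_eq_integral => //.
  - by apply/measurable_EFinP; exact: measurable_funM.
  - by apply/measurable_EFinP; exact: measurable_funM.
  - by apply: (@filterS _ _ (ae_filter_ringOfSetsType (leb R)) _ _ _ pq) => x H _;
        rewrite H.
by rewrite -(E f f') // -(E g g') //; exact: fg.
Qed.

Lemma Rintegral_segment_split (R : realType) (g : R -> R) (x y z : R) :
  (forall c d : R, (leb R).-integrable `[c, d] (EFin \o g)) ->
  x <= y -> y <= z ->
  \int[leb R]_(t in `[x, z]) g t =
  \int[leb R]_(t in `[x, y]) g t + \int[leb R]_(t in `[y, z]) g t.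
Proof.
move=> I xy yz; apply/eqP; rewrite addrC -subr_eq; apply/eqP.
rewrite /leb Rintegral_itvB //=.
rewrite Rintegral_itv_obnd_cbnd //.
by apply: integrableS (I y z) => //; apply: subset_itvr; rewrite bnd_simp.
Qed.

Lemma primitive_exists (R : realType) (g : R -> R) :
  (forall c d : R, (leb R).-integrable `[c, d] (EFin \o g)) ->
  exists P : R -> R, forall x y, x <= y -> P y - P x = \int[leb R]_(t in `[x, y]) g t.
Proof.
move=> I; exists (fun y => if 0 <= y then \int[leb R]_(t in `[0, y]) g t
                 else - \int[leb R]_(t in `[y, 0]) g t) => x y xy.
have S := fun x y z => @Rintegral_segment_split _ g x y z I.
case: (leP 0 y) => y0; case: (leP 0 x) => x0.
- by rewrite (S 0 x y) // addrC addKr.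
- by rewrite (S x 0 y (ltW x0)) // opprK addrC.
- by have := le_lt_trans xy y0; rewrite ltNge x0.
- by rewrite (S x y 0 xy (ltW y0)) opprK addrC addrK.
Qed.

Lemma lipschitz_continuous (R : realType) (F : R -> R) (M : R) :
  (forall x y, x <= y -> `|F y - F x| <= M * (y - x)) -> continuous F.
Proof.
move=> H; have M0 : 0 <= M.
  by have := H 0 1 ler01; rewrite subr0 mulr1; exact: le_trans.
have {}H x y : `|F x - F y| <= M * `|x - y|.
  case: (leP x y) => xy; first by rewrite distrC (distrC x) (ger0_norm (_ : 0 <= y - x))
      ?subr_ge0 // H.
  by rewrite (ger0_norm (_ : 0 <= x - y)) ?subr_ge0 ?(ltW xy) // H // ltW.
move=> x; apply/cvgrPdist_le => e e0; near=> y.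
apply: (le_trans (H x y)).
apply: (@le_trans _ _ (M * (e / (M + 1)))).
  apply: ler_wpM2l => //; near: y; apply: cvgr_dist_le; first exact: cvg_id.
  by rewrite divr_gt0 //; lra.
by rewrite mulrA ler_pdivrMr; [rewrite mulrC; nra|lra].
Unshelve. all: by end_near. Qed.

Lemma ae_itv_exists (R : realType) (P : R -> Prop) (p q : R) : p < q ->
  {ae leb R, forall x, P x} -> exists2 x, p < x < q & P x.
Proof.
move=> pq [N [mN N0 HN]]; apply: contrapT => no.
have sub : `]p, q[ `<=` N.
  move=> x /=; rewrite in_itv /= => pxq; apply: HN => /= Px.
  by apply: no; exists x.
have : (leb R `]p, q[%classic <= leb R N)%E by apply: le_measure => //; rewrite inE.
rewrite [X in (_ <= X)%E]N0 /= /leb lebesgue_measure_itv /= lte_fin pq -EFinD lee_fin; lra.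
Qed.

Lemma ae_le_continuous (R : realType) (a b c : R) (f : R -> R) : a < b ->
  continuous f -> {ae leb R, forall x, a <= x <= b -> f x <= c} ->
  forall x, a <= x <= b -> f x <= c.
Proof.
move=> ab cf fc x /andP[ax xb]; rewrite leNgt; apply/negP => cfx.
have : \forall y \near x, c < f y by apply: (cvgr_gt _ (cf x)).
move=> [/= e e0 He].
have pq : Num.max a (x - e) < Num.min b (x + e).
  by case: (leP a (x - e)) => ?; case: (leP b (x + e)) => ?; lra.
have [y + Hy] := ae_itv_exists pq fc.
rewrite gt_max lt_min => /andP[/andP[y1 y2] /andP[y3 y4]].
have : f y <= c by apply: Hy; rewrite (ltW y1) (ltW y3).
apply/negP; rewrite -ltNge; apply: He.
by rewrite /= ltr_norml; apply/andP; split; lra.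
Qed.

Lemma ae_eq_continuous (R : realType) (f g : R -> R) :
  continuous f -> continuous g -> {ae leb R, forall x, f x = g x} -> f = g.
Proof.
move=> cf cg fg; apply/funext => x; apply/eqP;
    rewrite eq_le -subr_le0 -[X in _ && X]subr_le0.
have A (p q : R -> R) : continuous p -> continuous q -> {ae leb R, forall x, p x = q x} ->
    p x - q x <= 0.
  move=> cp cq pq; apply: (@ae_le_continuous _ (x - 1) (x + 1) 0 (fun x => p x - q x)).
  - lra.
  - by move=> y; apply: cvgB; [exact: cp|exact: cq].
  - by apply: (@filterS _ _ (ae_filter_ringOfSetsType (leb R)) _ _ _ pq) => y -> _;
        rewrite subrr.
  - by apply/andP; split; lra.
by rewrite !A //; apply: (@filterS _ _ (ae_filter_ringOfSetsType (leb R)) _ _ _ fg) => y ->.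
Qed.

(** [F] is a primitive of the clipped weak derivative, normalised at one Lebesgue point [x0] of the
    clipped [f']. Almost every point is a Lebesgue point, and there [weak_derivative_ftc] forces
    [f' = F]. *)
Lemma weak_derivative_primitive (R : realType) (f g : R -> R) :
  f \in Lfun (leb R) +oo%E -> g \in Lfun (leb R) +oo%E -> is_weak_derivative f g ->
  exists F g' : R -> R, [/\ continuous F,
    {ae leb R, forall x, f x = F x}, {ae leb R, forall x, g x = g' x},
    measurable_fun [set: measurableTypeR R] g' &
    forall x y, x <= y -> F y - F x = \int[leb R]_(t in `[x, y]) g' t].
Proof.
move=> /Lfun_oo_bounded[mf [M1 [f' [mf' fM ff]]]].
move=> /Lfun_oo_bounded[mg [M2 [g' [mg' gM gg]]]] fg.
have {}fg := is_weak_derivative_ae mf mf' mg mg' ff gg fg.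
have [P HP] := primitive_exists (fun c d => segment_integrable c d mg' gM).
have M : forall x, `|f' x| <= Num.max M1 M2 by move=> x; rewrite le_max fM.
have M' : forall x, `|g' x| <= Num.max M1 M2 by move=> x; rewrite le_max gM orbT.
have locf : locally_integrable [set: R] f'.
  split; [exact: mf'|exact: openT|].
  move=> K _ cK.
  have : (leb R).-integrable K (EFin \o f').
    apply: measurable_bounded_integrable => //.
    - exact: compact_measurable.
    - exact: compact_finite_measure.
    - exact: measurable_funTS.
    - exists M1; split; first exact: num_real.
      by move=> x Kx y _ /=; apply: (le_trans (fM y)); exact: ltW.
  by move=> /integrableP[].
have leb_ae := lebesgue_differentiation locf.
have [x0 _ lx0] := @ae_itv_exists _ _ 0 1 ltr01 leb_ae.
exists (fun x => f' x0 + (P x - P x0)), g'; split => //.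
- have Pc : continuous P.
    apply: (@lipschitz_continuous _ _ M2) => x y xy; rewrite HP //.
    apply: Rintegral_segment_le => //; exact: segment_integrable mg' gM.
  by move=> x; apply: cvgD; [exact: cvg_cst|apply: cvgB; [exact: Pc|exact: cvg_cst]].
- apply: (@filterS2 _ _ (ae_filter_ringOfSetsType (leb R)) _ _ _ _ leb_ae ff).
  move=> x lx ->; case: (leP x0 x) => x0x.
    by rewrite HP // -(weak_derivative_ftc mf' mg' M M' fg x0x) // addrC subrK.
  rewrite -(opprB (P x0)) HP ?(ltW x0x) //.
  rewrite -(weak_derivative_ftc mf' mg' M M' fg (ltW x0x)) //; ring.
- by move=> x y xy; rewrite -HP //; ring.
Qed.

Lemma is_derive_of_integral (R : realType) (F f : R -> R) : continuous f ->
  (forall x y, x <= y -> F y - F x = \int[leb R]_(t in `[x, y]) f t) ->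
  forall x : R, is_derive x 1 F (f x).
Proof.
move=> cf HF x.
have xx1 : x < x + 1 by lra.
have I : lebesgue_measure.-integrable `[x - 1, x + 1] (EFin \o f).
  exact: continuous_segment_integrable.
have xm : x - 1 < x by lra.
have [dG GE] := continuous_FTC1_closed xx1 I xm (cf x).
pose G y := \int[lebesgue_measure]_(t in `[x - 1, y]) f t.
have near_eq : \forall y \near x, (cst (F (x - 1)) + G) y = F y.
  near=> y; rewrite /GRing.add /= /G -HF; first by rewrite addrC subrK.
  by apply: ltW; near: y; exact: lt_nbhsr.
have dGx : is_derive x 1 (cst (F (x - 1)) + G) (f x).
  have D : is_derive x 1 G (f x) by split; [exact: dG|rewrite -derive1E; exact: GE].
  by rewrite -[f x]add0r; apply: is_deriveD.
exact: near_eq_is_derive dGx.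
Unshelve. all: by end_near. Qed.

(** One order is lost because the top weak derivative is merely bounded. Below it, the density in
    the integral formula for [F i] agrees almost everywhere with the continuous [F i.+1], so the
    fundamental theorem yields a classical derivative at every point. Continuity of [u] identifies
    [F 0] with [u] itself. *)
Lemma Winfty_smooth (R : realType) (m : nat) (u : R -> R) :
  continuous u -> in_Winfty m.+1 u ->
  exists F : nat -> R -> R, [/\ F 0%N = u,
    forall i, (i <= m)%N -> continuous (F i) /\
      {ae leb R, forall x, weak_derivativen i u x = F i x} &
    forall i, (i < m)%N -> forall x : R, is_derive x 1 (F i) (F i.+1 x)].
Proof.
move=> cu [uL uw].
have H i : exists Fg : (R -> R) * (R -> R), (i <= m)%N ->
  [/\ continuous Fg.1,
    {ae leb R, forall x, weak_derivativen i u x = Fg.1 x},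
    {ae leb R, forall x, weak_derivativen i.+1 u x = Fg.2 x},
    measurable_fun [set: measurableTypeR R] Fg.2 &
    forall x y, x <= y -> Fg.1 y - Fg.1 x = \int[leb R]_(t in `[x, y]) Fg.2 t].
  case: (leqP i m) => im; last by exists (u, u).
  have [F [g [*]]] := weak_derivative_primitive (uL i (leqW im)) (uL i.+1 im) (uw i im).
  by exists (F, g).
have [Fg HF] := choice H.
exists (fun i => (Fg i).1); split.
- have [cF uF _ _ _] := HF 0%N isT.
  by symmetry; exact: ae_eq_continuous.
- by move=> i im; have [] := HF i im.
- move=> i im; have [cF uF ug mg HFg] := HF i (ltnW im).
  have [cF1 uF1 _ _ _] := HF i.+1 im.
  apply: is_derive_of_integral => // x y xy.
  rewrite HFg //; congr fine; apply: ae_eq_integral => //.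
  + by apply/measurable_EFinP; exact: measurable_funTS.
  + by apply/measurable_EFinP; apply: measurable_funTS; exact: continuous_measurable_fun.
  + apply: (@filterS2 _ _ (ae_filter_ringOfSetsType (leb R)) _ _ _ _ ug uF1).
    by move=> z <- <- _.
Qed.

Lemma LpNorm_oo_ge (R : realType) (a b : R) (f F : R -> R) : a < b -> continuous F ->
  {ae leb R, forall x, f x = F x} ->
  forall x, a <= x <= b -> (`|F x|%:E <= LpNorm +oo `[a, b] f)%E.
Proof.
move=> ab cF fF x axb; rewrite /LpNorm unlock /= leb_setT_gt0.
set e := ess_sup _ _.
have He := ess_sup_ge (leb R) (abse \o (EFin \o (f \_ `[a, b]))).
rewrite -/e in He.
have e0 : (0 <= e)%E.
  have [y _ Hy] := ae_itv_exists ab He.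
  by apply: le_trans Hy; rewrite /= lee_fin.
move: e0 He; case: e => [c|_ _|] //; last by rewrite leey.
move=> _ Hc; rewrite lee_fin.
apply: (@ae_le_continuous _ a b c (fun x => `|F x|)) => //.
  by move=> y; apply: continuous_comp; [exact: cF|exact: norm_continuous].
apply: (@filterS2 _ _ (ae_filter_ringOfSetsType (leb R)) _ _ _ _ Hc fF).
move=> y /= H <- ayb; move: H; rewrite patchE mem_setE in_itv /= ayb.
by rewrite lee_fin.
Qed.

(* [F i] is the continuous representative of the [i]-th weak derivative. *)
Lemma periodic_Winfty_smooth (R : realType) (m : nat) (a b : R) (u : R -> R) : a < b ->
  periodic_Winfty m.+1 a b u ->
  exists F : nat -> R -> R, [/\ F 0%N = u,
    forall i, (i <= m)%N -> continuous (F i),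
    forall i, (i < m)%N -> forall x : R, is_derive x 1 (F i) (F i.+1 x),
    forall i x, (i <= m)%N -> F i (x + (b - a)) = F i x &
    forall i x, (i <= m)%N -> (`|F i x|%:E <= WinftyNorm m.+1 `[a, b] u)%E].
Proof.
move=> ab [per cu Wu]; have [F [F0 cF dF]] := Winfty_smooth cu Wu.
have perF i x : (i <= m)%N -> F i (x + (b - a)) = F i x.
  elim: i x => [|i IH] x im; first by rewrite F0.
  have D1 := dF i im x.
  have D2 := dF i im (x + (b - a)).
  have E : F i \o (fun x => x + (b - a)) = F i by apply/funext => y /=; rewrite IH // ltnW.
  have D3 : is_derive x 1 (F i \o (fun x => x + (b - a))) (F i.+1 (x + (b - a)) * 1).
    apply: is_derive1_comp; apply: is_derive_eq; rewrite ?addr0 //.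
  rewrite E mulr1 in D3.
  by rewrite -(@derive_val _ _ _ _ _ _ _ D3) (@derive_val _ _ _ _ _ _ _ D1).
exists F; split => // [i im|i x im]; first by have [] := cF i im.
(* The norm sees only [[a, b]]: an arbitrary point is brought there by a whole number of periods,
   possibly negative. *)
have [y [ayb ->]] : exists y, a <= y <= b /\ F i x = F i y.
  have L0 : 0 < b - a by lra.
  have perz (n : int) z : F i (z + n%:~R * (b - a)) = F i z.
    case: n => n.
      elim: n z => [|n IH] z; first by rewrite mul0r addr0.
      by rewrite -addn1 PoszD rmorphD mulrDl mul1r addrA perF.
    rewrite NegzE; elim: n.+1 z => [|n0 IH] z; first by rewrite mul0r addr0.
    rewrite -[RHS]IH -[LHS]perF //; congr (F i _).
    by rewrite -[n0.+1]addn1 PoszD opprD rmorphD mulrDl /= -addrA; congr (_ + _);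
        rewrite mulN1r -addrA addNr addr0.
  pose n := Num.floor ((x - a) / (b - a)).
  exists (x + (- n)%:~R * (b - a)); rewrite perz; split => //.
  have n1 : n%:~R <= (x - a) / (b - a) by exact: Num.Theory.floor_le.
  have n2 : (x - a) / (b - a) < n%:~R + 1 by have := floorD1_gt ((x - a) / (b - a));
      rewrite intrD.
  move: n1 n2; rewrite ler_pdivlMr // ltr_pdivrMr // rmorphN /= => *.
  by apply/andP; split; lra.
have [_ uF] := cF i im.
apply: (le_trans (LpNorm_oo_ge ab (proj1 (cF i im)) uF ayb)).
rewrite /WinftyNorm (bigD1 (Ordinal (leqW im : (i < m.+2)%N))) //=.
by rewrite leeDl // sume_ge0 // => j _; exact: Lnorm_ge0.
Qed.

(** * Legendre polynomials on the reference cell [[-1, 1]] *)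

Lemma poly_eq0_of_roots (R : realType) (p : {poly R}) :
  (forall x, -1 <= x <= 1 -> p.[x] = 0) -> p = 0.
Proof.
move=> H; apply: contrapT => /eqP p0.
pose rs : seq R := [seq (i.+1%:R)^-1 | i <- iota 0 (size p)].
have := max_poly_roots p0 (rs := rs).
rewrite size_map size_iota ltnn => R0; suff : false by [].
apply: R0.
- apply/allP => x /mapP[i _ ->]; apply/rootP; apply: H.
  have i0 : (0 : R) < i.+1%:R by rewrite ltr0n.
  rewrite invf_le1 // ler1n andbT; apply: (@le_trans _ _ 0); first lra.
  by rewrite invr_ge0 ltW.
- rewrite map_inj_uniq ?iota_uniq // => i j /invr_inj /eqP.
  by rewrite eqr_nat eqSS => /eqP.
Qed.

(** These are the Taylor coefficients at [c]. Derivatives of [('X^2 - 1) ^+ n] at 1 and -1 thereby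
    become coefficients of an explicit product. *)
Lemma coef_comp_translate (R : realType) (p : {poly R}) (c : R) (i : nat) :
  (p \Po ('X + c%:P))`_i = p^`N(i).[c].
Proof.
have -> : p \Po ('X + c%:P) = \poly_(i < size p) p^`N(i).[c].
  apply/eqP; rewrite -subr_eq0; apply/eqP; apply: poly_eq0_of_roots => x _.
  rewrite hornerD hornerN horner_comp !hornerE horner_poly.
  rewrite (addrC x c) nderiv_taylor; last exact: mulrC.
  by rewrite subrr.
rewrite coef_poly; case: ltnP => // ip.
rewrite (_ : p^`N(i) = 0) ?horner0 //.
by apply/polyP => j; rewrite coef_nderivn nth_default ?mul0rn ?coef0 // (leq_trans ip) //
    leq_addr.
Qed.

(* Rodrigues' formula; the divided derivative ^`N(n) contains the factor 1 / n!. *)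
Definition legendre (R : realType) (n : nat) : {poly R} :=
  (2 ^+ n)^-1 *: (('X^2 - 1) ^+ n)^`N(n).

Lemma sqr_sub1_factor (R : realType) (c : R) (n : nat) : c ^+ 2 = 1 ->
  (('X^2 - 1) ^+ n) \Po ('X + c%:P) = 'X^n * ('X + (2 * c)%:P) ^+ n.
Proof.
move=> c1; rewrite rmorphXn /= -exprMn; congr (_ ^+ n).
rewrite rmorphB rmorph1 /= comp_Xn_poly polyCM.
have -> : 1 = (c%:P) ^+ 2 :> {poly R} by rewrite -polyC_exp c1.
have -> : 2%:P = 2 :> {poly R} by rewrite -[RHS]/(2%:R) -polyC_natr.
ring.
Qed.

(** After translation by [c], the value and the slope are read off coefficients 0 and 1 of
    [('X + 2c)^n], namely [(2c)^n] and [n (2c)^(n-1)]. The slope gains the factor [n + 1] when the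
    divided derivative of order [n] is differentiated. *)
Lemma horner_legendre (R : realType) (n : nat) (c : R) : c ^+ 2 = 1 ->
  (legendre R n).[c] = c ^+ n /\
  (legendre R n)^`().[c] = c ^+ n.+1 * (n%:R * n.+1%:R) / 2.
Proof.
move=> c1; have c0 : c != 0.
  by apply/eqP => c0; move: c1; rewrite c0 expr0n => /eqP; rewrite eq_sym oner_eq0.
have e0 : (2 : R) ^+ n != 0 by rewrite expf_neq0 // pnatr_eq0.
have co i : (('X^2 - 1 : {poly R}) ^+ n)^`N(n + i).[c] = (('X + (2 * c)%:P) ^+ n)`_i.
  by rewrite -coef_comp_translate sqr_sub1_factor // coefXnM ltnNge leq_addr /= addKn.
rewrite /legendre derivZ !hornerZ; split.
  have := co 0%N; rewrite addn0 => ->.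
  rewrite -horner_coef0 horner_exp hornerD hornerX hornerC add0r exprMn.
  by rewrite mulrA mulVf // mul1r.
have -> : ((('X^2 - 1 : {poly R}) ^+ n)^`N(n))^`() = (('X^2 - 1) ^+ n)^`N(n.+1) *+ n.+1.
  apply/polyP => i; rewrite coef_deriv !coefMn !coef_nderivn addSnnS -!mulrnA.
  congr (_ *+ _).
  have := mul_bin_left (n + i.+1) n; rewrite addKn => E.
  by rewrite [RHS]mulnC E mulnC.
rewrite hornerMn; have := co 1%N; rewrite addn1 => ->.
case: n e0 {co} => [|n] e0.
  by rewrite expr0 coef1 /= !(mul0r, mulr0, mul0rn).
rewrite (addrC 'X) (exprDn _ 'X).
rewrite coef_sum (bigD1 (Ordinal (isT : (1 < n.+2)%N))) //= big1 ?addr0; last first.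
  move=> j jn; rewrite coefMn -polyC_exp coefCM coefXn.
  rewrite (_ : (1%N == j) = false) ?mulr0 ?mul0rn //.
  by apply/negbTE; rewrite eq_sym -val_eqE /= in jn *.
rewrite coefMn -polyC_exp coefCM coefXn eqxx mulr1 bin1 subn1 /= exprMn.
have c2 : c ^+ n.+2 = c ^+ n by rewrite -addn2 exprD c1 mulr1.
rewrite c2 exprS -[X in _ * X = _]mulr_natr -[X in _ * (X * _) = _]mulr_natr; field.
by rewrite expf_neq0 // pnatr_eq0.
Qed.

(** Repeated integration by parts carried out on polynomials: each step lowers the size of [q], and
    every boundary term contains a derivative of [f] of order below [n]. *)
Lemma rodrigues_antiderivative (R : realType) (n : nat) (f q : {poly R}) :
  (forall i, (i < n)%N -> f^`(i).[1] = 0 /\ f^`(i).[-1] = 0) -> (size q <= n)%N ->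
  exists Q : {poly R}, [/\ Q^`() = f^`(n) * q, Q.[1] = 0 & Q.[-1] = 0].
Proof.
elim: n q => [|n IH] q Hf sq.
  exists 0; rewrite deriv0 !horner0.
  by move: sq; rewrite leqn0 size_poly_eq0 => /eqP ->; rewrite mulr0.
have sq' : (size q^`() <= n)%N.
  by apply/leq_sizeP => j nj; rewrite coef_deriv nth_default ?mul0rn // (leq_trans sq).
have [Q [dQ Q1 Q2]] := IH q^`() (fun i hi => Hf i (ltnW hi)) sq'.
have [f1 f2] := Hf n (ltnSn n).
exists (f^`(n) * q - Q); split.
- by rewrite derivB derivM dQ derivnS; ring.
- by rewrite hornerD hornerN hornerM f1 Q1 mul0r subrr.
- by rewrite hornerD hornerN hornerM f2 Q2 mul0r subrr.
Qed.

Lemma legendre_orthogonal (R : realType) (n : nat) (q : {poly R}) : (size q <= n)%N ->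
  \int[leb R]_(x in `[-1, 1]) ((legendre R n).[x] * q.[x]) = 0.
Proof.
move=> sq; pose f : {poly R} := ('X^2 - 1) ^+ n.
have Hf i : (i < n)%N -> f^`(i).[1] = 0 /\ f^`(i).[-1] = 0.
  move=> i_n; have H c : c ^+ 2 = 1 -> f^`(i).[c] = 0.
    move=> c1; rewrite nderivn_def hornerMn -coef_comp_translate sqr_sub1_factor //.
    by rewrite coefXnM i_n mul0rn.
  by rewrite !H ?sqrrN ?expr1n.
have [Q [dQ Q1 Q2]] := rodrigues_antiderivative Hf sq.
pose a : R := (2 ^+ n)^-1 / n`!%:R.
have n0 : (n`!%:R : R) != 0 by rewrite pnatr_eq0 -lt0n fact_gt0.
have E x : (legendre R n).[x] * q.[x] = (a *: Q)^`().[x].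
  rewrite derivZ dQ nderivn_def hornerZ hornerM hornerMn /legendre hornerZ -/f /a.
  rewrite -(mulr_natr f^`N(n).[x]); move: (n`!%:R) n0 => m m0.
  rewrite -!mulrA; congr (_ * _).
  by rewrite [RHS]mulrCA mulKf.
under eq_Rintegral do rewrite E.
rewrite (@Rintegral_FTC _ (horner (a *: Q))).
- by rewrite !hornerZ Q1 Q2 !mulr0 subrr.
- lra.
- exact: continuous_horner.
Qed.

Lemma coef_legendre (R : realType) (n : nat) :
  (size (legendre R n) <= n.+1)%N /\ (legendre R n)`_n != 0.
Proof.
pose f : {poly R} := ('X^2 - 1) ^+ n.
have sX : size ('X^2 - 1 : {poly R}) = 3%N by rewrite -polyC1 size_XnsubC.
have sf : size f = (n + n).+1.
  have := size_exp ('X^2 - 1 : {poly R}) n; rewrite sX /= mul2n -addnn -/f => <-.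
  rewrite prednK // lt0n size_poly_eq0 expf_neq0 //.
  by rewrite -size_poly_eq0 sX.
have lf : f`_(n + n) = 1.
  have -> : (n + n)%N = (size f).-1 by rewrite sf.
  by rewrite -/(lead_coef f) lead_coef_exp -polyC1 lead_coefXnsubC // expr1n.
split.
  apply/leq_sizeP => j nj; rewrite coefZ coef_nderivn -/f nth_default ?mul0rn ?mulr0 //.
  by rewrite sf ltn_add2l.
rewrite coefZ coef_nderivn -/f lf mulf_eq0 invr_eq0 expf_eq0 !pnatr_eq0 andbF /=.
by rewrite -lt0n bin_gt0 leq_addr.
Qed.

Lemma continuous_hornerM (R : realType) (f : R -> R) (p : {poly R}) :
  continuous f -> continuous (fun x => f x * p.[x]).
Proof. by move=> cf x; apply: cvgM; [exact: cf|exact: continuous_horner]. Qed.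

Lemma poly_self_orthogonal (R : realType) (p : {poly R}) :
  \int[leb R]_(x in `[-1, 1]) (p.[x] * p.[x]) = 0 -> p = 0.
Proof.
move=> H; have cp : continuous (fun x : R => p.[x] * p.[x]).
  by apply: continuous_hornerM; exact: continuous_horner.
have I : (leb R).-integrable `[-1, 1] (EFin \o (fun x => p.[x] * p.[x])).
  exact: continuous_segment_integrable.
have mp : measurable_fun `[(-1 : R), 1] (EFin \o (fun x => p.[x] * p.[x])).
  exact: (measurable_int (leb R) I).
have /(ae_eq_integral_abs (leb R) (measurable_itv _) mp) ae0 :
    (\int[leb R]_(x in `[(-1)%R, 1%R]) `|(EFin \o (fun x => (p.[x] * p.[x])%R)) x| = 0)%E.
  under eq_integral do rewrite gee0_abs ?lee_fin ?sqr_ge0 //.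
  by rewrite -[LHS]fineK ?integrable_fin_num //
      -[X in X%:E]/(\int[leb R]_(x in `[-1, 1]) (p.[x] * p.[x])) H.
apply: poly_eq0_of_roots => x xI.
have : p.[x] * p.[x] <= 0.
  apply: (@ae_le_continuous _ (-1) 1 0 (fun x => p.[x] * p.[x]));
      [lra|exact: cp| |exact: xI].
  apply: (@filterS _ _ (ae_filter_ringOfSetsType (leb R)) _ _ _ ae0).
  by move=> y /= Hy yI; have := Hy; rewrite in_itv /= => /(_ yI) [] ->.
have := sqr_ge0 p.[x]; rewrite expr2 => p1 p2.
have /eqP : p.[x] * p.[x] = 0 by lra.
by rewrite mulf_eq0 orbb => /eqP.
Qed.

(** Subtracting multiples of the two Legendre polynomials removes the top two coefficients of [p].
    The remainder is then an admissible test polynomial, orthogonal to itself. *)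
Lemma orthogonal_legendre_span (R : realType) (k : nat) (p : {poly R}) : (1 <= k)%N ->
  (size p <= k.+1)%N ->
  (forall q : {poly R}, (size q <= k.-1)%N ->
     \int[leb R]_(x in `[-1, 1]) (p.[x] * q.[x]) = 0) ->
  exists c1 c2, p = c1 *: legendre R k.-1 + c2 *: legendre R k.
Proof.
case: k => // k _ /= sp orth.
have [s1 l1] := coef_legendre R k; have [s2 l2] := coef_legendre R k.+1.
pose c2 := p`_k.+1 / (legendre R k.+1)`_k.+1.
pose p1 := p - c2 *: legendre R k.+1.
have sp1 : (size p1 <= k.+1)%N.
  apply/leq_sizeP => j; rewrite leq_eqVlt => /orP[/eqP <-|kj].
    by rewrite coefB coefZ /c2 mulfVK // subrr.
  by rewrite coefB coefZ !nth_default ?mulr0 ?subrr // ?(leq_trans sp) ?(leq_trans s2).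
pose c1 := p1`_k / (legendre R k)`_k.
pose p2 := p1 - c1 *: legendre R k.
have sp2 : (size p2 <= k)%N.
  apply/leq_sizeP => j; rewrite leq_eqVlt => /orP[/eqP <-|kj].
    by rewrite coefB coefZ /c1 mulfVK // subrr.
  by rewrite coefB coefZ !nth_default ?mulr0 ?subrr // ?(leq_trans sp1) ?(leq_trans s1).
have cI (r s : {poly R}) : (leb R).-integrable `[-1, 1] (EFin \o (fun x => r.[x] * s.[x])).
  by apply: continuous_segment_integrable; apply: continuous_hornerM;
      exact: continuous_horner.
exists c1, c2.
suff : p2 = 0 by move/eqP; rewrite /p2 /p1 subr_eq0 subr_eq => /eqP.
apply: poly_self_orthogonal.
transitivity (\int[leb R]_(x in `[-1, 1])
    ((p.[x] * p2.[x] - (c2 *: legendre R k.+1).[x] * p2.[x])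
   - (c1 *: legendre R k).[x] * p2.[x])).
  by apply: eq_Rintegral => x _; rewrite {1}/p2 {1}/p1 !(hornerD, hornerN); ring.
have Z c n : (k <= n)%N -> \int[leb R]_(x in `[-1, 1]) ((c *: legendre R n).[x] * p2.[x])
    = 0.
  move=> kn; under eq_Rintegral do rewrite hornerZ -mulrA.
  by rewrite RintegralZl ?legendre_orthogonal ?mulr0 // (leq_trans sp2).
rewrite RintegralB //; first by rewrite RintegralB // orth // !Z // ?subr0 // .
apply: continuous_segment_integrable => x.
by apply: cvgB; apply: continuous_hornerM; exact: continuous_horner.
Qed.

(** * The local projection: uniqueness, stability and error *)

(** Unisolvence makes the matrix of the functionals on monomials invertible, and its inverse bounds
    the coefficients by the data. [C] depends on the functionals alone. *)
Lemma unisolvent_bound (R : realType) (n : nat) (phi : 'I_n -> {poly R} -> R) :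
  (forall i c p q, phi i (c *: p + q) = c * phi i p + phi i q) ->
  (forall p : {poly R}, (size p <= n)%N -> (forall i, phi i p = 0) -> p = 0) ->
  exists2 C : R, 0 <= C & forall (p : {poly R}) B, (size p <= n)%N ->
    (forall i, `|phi i p| <= B) -> forall x, -1 <= x <= 1 ->
    `|p.[x]| <= C * B /\ `|p^`().[x]| <= C * B.
Proof.
move=> lin uni.
have phi0 i : phi i 0 = 0.
  have := lin i 1 0 0; rewrite scale1r addr0 mul1r => /eqP.
  by rewrite -subr_eq0 opprD addrA subrr sub0r oppr_eq0 => /eqP.
pose A : 'M[R]_n := \matrix_(i, j) phi j 'X^i.
have phiE (v : 'rV[R]_n) j : phi j (rVpoly v) = (v *m A) 0 j.
  have -> : rVpoly v = \sum_i v 0 i *: 'X^i.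
    rewrite /rVpoly poly_def; apply: eq_bigr => i _.
    by rewrite valK.
  rewrite !mxE; elim/big_rec2: _ => [|i y1 y2 _ IH]; first by rewrite phi0.
  by rewrite lin IH mxE.
have Au : A \in unitmx.
  rewrite -row_free_unit; apply/row_freeP; apply: contrapT => nA.
  have : ~~ row_free A by apply/negP => /row_freeP.
  rewrite -kermx_eq0 => /rowV0Pn[v /sub_kermxP vA]; apply/negP; rewrite negbK.
  have sv : (size (rVpoly v) <= n)%N by exact: size_poly.
  have r0 := uni _ sv (fun j => _); rewrite -(rVpolyK v) r0 ?linear0 // => j.
  by rewrite phiE vA mxE.
pose S := \sum_i \sum_j `|invmx A j i|.
have S0 : 0 <= S by apply: sumr_ge0 => i _; apply: sumr_ge0.
have coefb (p : {poly R}) B : (size p <= n)%N -> (forall i, `|phi i p| <= B) ->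
    forall i : 'I_n, `|p`_i| <= B * S.
  move=> sp Hp i; pose v := poly_rV p : 'rV[R]_n.
  have -> : p`_i = v 0 i by rewrite mxE.
  have -> : v = (v *m A) *m invmx A by rewrite mulmxK.
  rewrite mxE; apply: le_trans (ler_norm_sum _ _ _) _.
  apply: (@le_trans _ _ (\sum_j B * `|invmx A j i|)).
    apply: ler_sum => j _; rewrite normrM ler_wpM2r //.
    by rewrite -phiE /v poly_rV_K.
  rewrite -mulr_sumr ler_wpM2l //.
    by apply: le_trans (Hp i).
  rewrite /S [leRHS](bigD1 i) //= lerDl.
  by apply: sumr_ge0 => ? _; apply: sumr_ge0.
(* There are [n] coefficients, and on [[-1, 1]] a monomial of degree below [n] and its derivative
   are at most [n] in absolute value. *)
exists (S * (n%:R * n%:R)); first by rewrite !mulr_ge0.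
move=> p B sp Hp x xI.
have x1 : `|x| <= 1 by rewrite ler_norml.
have xn m : `|x ^+ m| <= 1 by rewrite normrX exprn_ile1.
have pE : p = \sum_(i < n) p`_i *: 'X^i.
  rewrite -[LHS](@coefK _ p) poly_def (big_ord_widen n (fun i => p`_i *: 'X^i)) //
      big_mkcond /=.
  by apply: eq_bigr => i _; case: ltnP => // ip; rewrite nth_default // scale0r.
have bound (c : 'I_n -> R) : (forall i, `|c i| <= n%:R) ->
    `|\sum_(i < n) p`_i * c i| <= S * (n%:R * n%:R) * B.
  move=> cn; apply: le_trans (ler_norm_sum _ _ _) _.
  apply: (@le_trans _ _ (\sum_(i < n) (B * S * n%:R))).
    by apply: ler_sum => i _; rewrite normrM ler_pM // coefb.
  rewrite sumr_const card_ord -mulr_natr le_eqVlt; apply/orP; left; apply/eqP; ring.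
have n1 (i : 'I_n) : (1 : R) <= n%:R by rewrite ler1n (leq_ltn_trans _ (ltn_ord i)).
split.
  rewrite {1}pE horner_sum; under eq_bigr do rewrite hornerZ hornerXn.
  by apply: bound => i; apply: le_trans (xn i) (n1 i).
rewrite {1}pE raddf_sum horner_sum /=.
under eq_bigr do rewrite derivZ hornerZ derivXn hornerMn hornerXn -mulr_natr.
apply: bound => i; rewrite normrM normr_nat -[n%:R]mul1r ler_pM // ler_nat.
exact: ltnW.
Qed.

(** The value at 1 makes the coefficients of the two Legendre polynomials opposite; their slopes at
    -1 have opposite signs, so the slope of the difference is [k ^ 2] up to sign instead of
    cancelling. *)
Lemma local_projection_unique (R : realType) (k : nat) (p : {poly R}) : (1 <= k)%N ->
  (size p <= k.+1)%N ->
  (forall q : {poly R}, (size q <= k.-1)%N ->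
     \int[leb R]_(x in `[-1, 1]) (p.[x] * q.[x]) = 0) ->
  p.[1] = 0 -> p^`().[-1] = 0 -> p = 0.
Proof.
move=> hk sp orth p1 dp; have [c1 [c2 pE]] := orthogonal_legendre_span hk sp orth.
case: k hk {sp orth} pE => // k _ /= pE.
have s1 : (1 : R) ^+ 2 = 1 by rewrite expr1n.
have sm : (-1 : R) ^+ 2 = 1 by rewrite sqrrN expr1n.
have [a1 _] := horner_legendre k s1.
have [a2 _] := horner_legendre k.+1 s1.
have [_ b1] := horner_legendre k sm.
have [_ b2] := horner_legendre k.+1 sm.
move: p1; rewrite {1}pE hornerD (hornerZ c1) (hornerZ c2) a1 a2 !expr1n !mulr1 => /eqP.
rewrite addrC addr_eq0 => /eqP E; rewrite {}E in pE.
move: dp; rewrite {1}pE derivD (derivZ c1) (derivZ (- c1)) hornerD (hornerZ c1)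
    (hornerZ (- c1)) b1 b2.
have -> : c1 * ((-1) ^+ k.+1 * (k%:R * k.+1%:R) / 2) + - c1 *
    ((-1) ^+ k.+2 * (k.+1%:R * k.+2%:R) / 2)
   = (-1) ^+ k.+1 * (c1 * k.+1%:R ^+ 2).
  have e1 : k.+1%:R = k%:R + 1 :> R by rewrite natr1.
  have e2 : k.+2%:R = k%:R + 1 + 1 :> R by rewrite !natr1.
  by rewrite [(-1) ^+ k.+2]exprS e1 e2; field.
move/eqP; rewrite !mulf_eq0 signr_eq0 pnatr_eq0 /= orbF => /eqP c10.
by rewrite pE c10 oppr0 !scale0r addr0.
Qed.

Lemma local_projection_bound (R : realType) (k : nat) : (1 <= k)%N ->
  exists2 C : R, 0 <= C & forall (p : {poly R}) B, (size p <= k.+1)%N ->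
    (forall i, (i < k.-1)%N -> `|\int[leb R]_(x in `[-1, 1]) (p.[x] * x ^+ i)| <= B) ->
    `|p.[1]| <= B -> `|p^`().[-1]| <= B ->
    forall x, -1 <= x <= 1 -> `|p.[x]| <= C * B /\ `|p^`().[x]| <= C * B.
Proof.
move=> hk.
(* The [k - 1] moments come first; index [k - 1] is the value at 1 and index [k] the slope at -1. *)
pose phi (f : 'I_k.+1) (p : {poly R}) := if (f < k.-1)%N then \int[leb R]_(x in `[-1, 1])
    (p.[x] * x ^+ f)
  else if f == k.-1 :> nat then p.[1] else p^`().[-1].
have cI (p q : {poly R}) : (leb R).-integrable `[-1, 1] (EFin \o (fun x => p.[x] * q.[x])).
  by apply: continuous_segment_integrable; apply: continuous_hornerM;
      exact: continuous_horner.
have cZ c (p q : {poly R}) : (leb R).-integrable `[-1, 1]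
    (EFin \o (fun x => c * (p.[x] * q.[x]))).
  apply: continuous_segment_integrable => x; apply: cvgM; first exact: cvg_cst.
  by apply: continuous_hornerM; exact: continuous_horner.
have lin i c p q : phi i (c *: p + q) = c * phi i p + phi i q.
  rewrite /phi; case: ifP => _; last first.
    by case: ifP => _; rewrite ?derivD ?derivZ hornerD hornerZ.
  transitivity (\int[leb R]_(x in `[-1, 1])
      (c * (p.[x] * ('X^i).[x]) + q.[x] * ('X^i).[x])).
    by apply: eq_Rintegral => x _; rewrite hornerD hornerZ !hornerXn; ring.
  rewrite RintegralD //.
  rewrite RintegralZl //; congr (_ * _ + _); apply: eq_Rintegral => x _;
      by rewrite hornerXn.
have uni (p : {poly R}) : (size p <= k.+1)%N -> (forall i, phi i p = 0) -> p = 0.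
  move=> sp H; apply: (local_projection_unique hk sp).
  - move=> q sq.
    have qE : q = \sum_(i < k.-1) q`_i *: 'X^i.
      rewrite -[LHS](@coefK _ q) poly_def (big_ord_widen k.-1 (fun i => q`_i *: 'X^i)) //
          big_mkcond /=.
      by apply: eq_bigr => i _; case: ltnP => // ip; rewrite nth_default // scale0r.
    rewrite qE; elim/big_rec: _ => [|i r _ IH].
      by under eq_Rintegral do rewrite horner0 mulr0; rewrite Rintegral_cst // mul0r.
    transitivity (\int[leb R]_(x in `[-1, 1])
        (q`_i * (p.[x] * ('X^i).[x]) + p.[x] * r.[x])).
      by apply: eq_Rintegral => x _; rewrite hornerD hornerZ !hornerXn; ring.
    rewrite RintegralD //.
    rewrite IH addr0 RintegralZl //.
    have ik : (i < k.+1)%N by apply: ltn_trans (ltn_ord i) _; rewrite prednK.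
    have := H (Ordinal ik); rewrite /phi /= ltn_ord => E.
    by under eq_Rintegral do rewrite hornerXn; rewrite E mulr0.
  - have kk : (k.-1 < k.+1)%N by rewrite prednK.
    by have := H (Ordinal kk); rewrite /phi /= ltnn eqxx.
  - have := H ord_max; rewrite /phi /= ltnNge leq_pred /= => <-.
    by rewrite gtn_eqF // ltn_predL.
have [C C0 HC] := unisolvent_bound lin uni.
exists C => // p B sp H1 H2 H3; apply: HC => // i; rewrite /phi.
by case: ifP => [/H1|_] //; case: ifP.
Qed.

Lemma taylor_interpolant (R : realType) (n : nat) (g : nat -> R) (c : R) :
  exists T : {poly R}, (size T <= n)%N /\ forall i, (i < n)%N -> T^`(i).[c] = g i.
Proof.
pose T0 : {poly R} := \poly_(i < n) (g i / i`!%:R).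
exists (T0 \Po ('X - c%:P)); split.
  by rewrite size_comp_poly2 ?size_poly // size_XsubC.
move=> i ilt; rewrite nderivn_def hornerMn -coef_comp_translate -comp_polyA.
rewrite (_ : ('X - c%:P) \Po ('X + c%:P) = 'X); last first.
  by rewrite comp_polyB comp_polyX comp_polyC addrK.
rewrite comp_polyXr coef_poly ilt -mulr_natr divfK //.
Qed.

(** Each application of the mean value theorem costs a factor 2, the length of the cell. Expanding
    at -1 makes the Taylor polynomial match exactly the slope that the local projection keeps. *)
Lemma taylor_remainder_bound (R : realType) (k : nat) (F : nat -> R -> R) (K : R) :
  (forall i, (i <= k)%N -> forall x : R, is_derive x 1 (F i) (F i.+1 x)) ->
  (forall x, -1 <= x <= 1 -> `|F k.+1 x| <= K) ->
  exists T : {poly R}, [/\ (size T <= k.+1)%N,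
    forall i, (i <= k)%N -> T^`(i).[-1] = F i (-1) &
    forall i, (i <= k.+1)%N -> forall x, -1 <= x <= 1 ->
      `|F i x - T^`(i).[x]| <= 2 ^+ (k.+1 - i) * K].
Proof.
move=> dF FK; have [T [sT HT]] := taylor_interpolant k.+1 (fun i => F i (-1)) (-1).
exists T; split => // i ik.
(* Reindexing lets the induction descend from the top derivative to the function. *)
rewrite -[i](subKn ik); move: (k.+1 - i)%N (leq_subr i k.+1) => {ik} {}i ik.
rewrite subKn //.
elim: i ik => [|i IH] ik x xI.
  rewrite subn0 expr0 mul1r.
  have -> : T^`(k.+1) = 0.
    by apply/polyP => j; rewrite coef_derivn coef0 nth_default ?mul0rn // (leq_trans sT) //
        leq_addr.
  by rewrite horner0 subr0 FK.
have e : (k.+1 - i)%N = (k.+1 - i.+1).+1 by rewrite subnSK.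
have jk : (k.+1 - i.+1 <= k)%N by rewrite subSS leq_subr.
move: (k.+1 - i.+1)%N e jk => j e jk.
have {}IH := IH (ltnW ik); rewrite e in IH.
have dr (y : R) : is_derive y 1 (fun y => F j y - T^`(j).[y]) (F j.+1 y - T^`(j.+1).[y]).
  have := dF j jk y; have := is_derive_poly T^`(j) y.
  by rewrite -derivnS => ? ?; apply: is_deriveB.
have x1 : -1 <= x by case/andP: xI.
have [c cI E] := MVT_segment x1 (fun y _ => dr y)
  (continuous_subspaceT (fun y => is_derive_continuous (dr y))).
have r0 : F j (-1) - T^`(j).[-1] = 0 by rewrite HT // subrr.
rewrite r0 subr0 opprK in E; rewrite E normrM.
have cI' : -1 <= c <= 1 by move: cI xI; rewrite in_itv /=; lra.
rewrite exprS -mulrA mulrC ler_pM //.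
  by rewrite ger0_norm; move: xI; lra.
exact: IH.
Qed.

(* [F] lists the projected function and its successive derivatives; [w] is the
   projection on the reference cell [-1, 1]. *)
Definition local_projection (R : realType) (k : nat) (F : nat -> R -> R) (w : {poly R}) :=
  [/\ forall i, (i <= k)%N -> forall x : R, is_derive x 1 (F i) (F i.+1 x),
      (size w <= k.+1)%N,
      forall q : {poly R}, (size q <= k.-1)%N ->
        \int[leb R]_(x in `[-1, 1]) ((F 0%N x - w.[x]) * q.[x]) = 0,
      F 0%N 1 = w.[1] & F 1%N (-1) = w^`().[-1]].

(** Through this linearity, the difference of the errors on neighbouring cells is again a projection
    error, that of the differenced data. *)
Lemma local_projectionB (R : realType) (k : nat) (F G : nat -> R -> R) (w z : {poly R}) :
  local_projection k F w -> local_projection k G z ->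
  local_projection k (fun i x => F i x - G i x) (w - z).
Proof.
move=> [dF sw mw w1 dw] [dG sz mz z1 dz]; split.
- by move=> i ik x; have := dF i ik x; have := dG i ik x => ? ?; apply: is_deriveB.
- by rewrite (leq_trans (size_polyD _ _)) // geq_max size_polyN sw.
- move=> q sq.
  have C (H : nat -> R -> R) (p : {poly R}) :
      (forall i, (i <= k)%N -> forall x : R, is_derive x 1 (H i) (H i.+1 x)) ->
      (leb R).-integrable `[-1, 1] (EFin \o (fun x => (H 0%N x - p.[x]) * q.[x])).
    move=> dH; apply: continuous_segment_integrable; apply: continuous_hornerM => x.
    by apply: cvgB; [exact: is_derive_continuous (dH 0%N isT x)|exact: continuous_horner].
  transitivity (\int[leb R]_(x in `[-1, 1])
      ((F 0%N x - w.[x]) * q.[x] - (G 0%N x - z.[x]) * q.[x])).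
    by apply: eq_Rintegral => x _; rewrite hornerD hornerN; ring.
  rewrite RintegralB //; [|exact: C|exact: C].
  by rewrite mw // mz // subrr.
- by rewrite w1 z1 hornerD hornerN.
- by rewrite dw dz derivB hornerD hornerN.
Qed.

(** With [T] the Taylor polynomial, [w - T] has the moments and endpoint data of [F 0 - T]. These
    are Taylor remainders, so stability bounds [w - T] and its derivative. *)
Lemma local_projection_error (R : realType) (k : nat) : (1 <= k)%N ->
  exists2 C : R, 0 <= C & forall (F : nat -> R -> R) (K : R) (w : {poly R}),
    local_projection k F w -> (forall x, -1 <= x <= 1 -> `|F k.+1 x| <= K) ->
    forall x, -1 <= x <= 1 -> `|F 0%N x - w.[x]| <= C * K /\ `|F 1%N x - w^`().[x]| <= C *
        K.
Proof.
move=> hk; have [C C0 HC] := local_projection_bound R hk.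
exists (2 ^+ k.+1 + C * (2 ^+ k.+1 * 2)).
  by rewrite addr_ge0 // !mulr_ge0 // exprn_ge0.
move=> F K w [dF sw mw w1 dw] FK.
have K0 : 0 <= K by apply: le_trans (FK 1 _) => //; lra.
have [T [sT Te Tr]] := taylor_remainder_bound dF FK.
have e2 : (1 : R) <= 2 ^+ k.+1 by rewrite exprn_ege1 // ler1n.
have T0 x : -1 <= x <= 1 -> `|F 0%N x - T.[x]| <= 2 ^+ k.+1 * K.
  by move=> xI; have := Tr 0%N isT x xI; rewrite derivn0 subn0.
have T1 x : -1 <= x <= 1 -> `|F 1%N x - T^`().[x]| <= 2 ^+ k.+1 * K.
  move=> xI; have := Tr 1%N isT x xI; rewrite derivn1 => /le_trans; apply.
  by rewrite ler_wpM2r // ler_weXn2l ?ler1n // leq_subr.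
(* The last factor 2 is the length of [[-1, 1]], picked up by the moments. *)
pose B := 2 ^+ k.+1 * 2 * K.
have AB : 2 ^+ k.+1 * K <= B by rewrite /B ler_wpM2r // ler_peMr ?ler1n //; lra.
have m1 : -1 <= (1 : R) <= 1 by lra.
have cF0 : continuous (F 0%N) by move=> x; exact: is_derive_continuous (dF 0%N isT x).
have HP := HC (w - T) B.
have {HP} HP x : -1 <= x <= 1 -> `|(w - T).[x]| <= C * B /\ `|(w - T)^`().[x]| <= C * B.
  apply: HP.
  - by rewrite (leq_trans (size_polyD _ _)) // geq_max size_polyN sw.
  - move=> i ik.
    have s_i : (size ('X^i : {poly R}) <= k.-1)%N by rewrite size_polyXn.
    have mi := mw _ s_i.
    have cc (p : {poly R}) : continuous (fun x => (F 0%N x - p.[x]) * ('X^i).[x]).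
      apply: continuous_hornerM => y.
      by apply: cvgB; [exact: cF0|exact: continuous_horner].
    have -> : \int[leb R]_(x in `[-1, 1]) ((w - T).[x] * x ^+ i) =
        \int[leb R]_(x in `[-1, 1]) ((F 0%N x - T.[x]) * ('X^i).[x]).
      rewrite -[RHS]subr0 -[X in _ = _ - X]mi -RintegralB //.
      - by apply: eq_Rintegral => y _; rewrite hornerXn hornerD hornerN; ring.
      - by apply: continuous_segment_integrable; exact: cc.
      - by apply: continuous_segment_integrable; exact: cc.
    have -> : B = 2 ^+ k.+1 * K * (1 - -1) by rewrite /B; ring.
    apply: Rintegral_segment_le; first lra.
      by apply: continuous_segment_integrable; exact: cc.
    move=> y yI; rewrite hornerXn normrM normrX -[leRHS]mulr1 ler_pM // ?T0 //.
    by rewrite exprn_ile1 // ler_norml.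
  - by rewrite hornerD hornerN -w1 (le_trans (T0 1 m1)).
  - rewrite derivB hornerD hornerN -dw -derivn1 Te // subrr normr0.
    by rewrite /B !mulr_ge0 // exprn_ge0.
have e : (2 ^+ k.+1 + C * (2 ^+ k.+1 * 2)) * K = 2 ^+ k.+1 * K + C * B by rewrite /B; ring.
move=> x xI; have [P0 P1] := HP x xI; split.
- rewrite (_ : F 0%N x - w.[x] = (F 0%N x - T.[x]) - (w - T).[x]); last
      by rewrite hornerD hornerN; ring.
  apply: le_trans (ler_normB _ _) _; rewrite e lerD //; exact: T0.
- rewrite (_ : F 1%N x - w^`().[x] = (F 1%N x - T^`().[x]) - (w - T)^`().[x]); last
      by rewrite derivB hornerD hornerN; ring.
  apply: le_trans (ler_normB _ _) _; rewrite e lerD //; exact: T1.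
Qed.

(** * Periodic recursions and the interface system *)

(* On an odd number of periodic nodes the alternating recursion x_j + x_{j+1} = y_j
   is inverted by a telescoping sum, which costs one difference of y per step. *)
Lemma alternating_bound (R : realType) (N : nat) (x y : nat -> R) (Y0 Y1 : R) :
  odd N -> (forall j, x (j + N)%N = x j) -> (forall j, x j + x j.+1 = y j) ->
  (forall j, `|y j| <= Y0) -> (forall j, `|y j.+1 - y j| <= Y1) ->
  forall j, `|x j| <= Y0 + N%:R * Y1.
Proof.
move=> oN per rec y0 y1 j.
have tele m : `|x (j + m.*2)%N - x j| <= m%:R * Y1.
  elim: m => [|m IH]; first by rewrite addn0 subrr normr0 mul0r.
  have := y1 (j + m.*2)%N; rewrite -!rec doubleS !addnS.
  rewrite -natr1 mulrDl mul1r; move: IH; rewrite !ler_norml; lra.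
have := tele N./2.
have Y10 : 0 <= Y1 by apply: le_trans (y1 0%N).
(* Since [N] is odd, [j + (N./2).*2] is [j + N - 1], where periodicity brings back [x j] with a
   minus sign. Telescoping says that the same value is close to [x j], so the two together control
   [2 * x j]. *)
have xN : x (j + (N./2).*2)%N = y (j + (N./2).*2)%N - x j.
  rewrite -rec -[in RHS](per j) -{4}(odd_double_half N) oN add1n addnS; ring.
have NE : N%:R = 1 + 2 * (N./2)%:R :> R.
  by rewrite -{1}(odd_double_half N) oN natrD -mul2n natrM.
rewrite xN NE; move: (y0 (j + (N./2).*2)%N) (ler0n R N./2).
move: (y _) (x j) => z t hz m0.
have : 0 <= (N./2)%:R * Y1 by exact: mulr_ge0.
move: hz; rewrite !ler_norml mulrDl mul1r -mulrA.
move: ((N./2)%:R * Y1) => m; lra.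
Qed.

(** The sums [s] of consecutive terms solve an alternating recursion with data [G], and the
    differences of [s] solve one with the differenced data. Feeding both bounds into the recursion
    for [c] gives the weights 1, [2 N] and [N ^ 2]. *)
Lemma double_alternating_bound (R : realType) (N : nat) (c G : nat -> R) (G0 G1 G2 : R) :
  odd N -> (forall j, c (j + N)%N = c j) ->
  (forall j, c j + 2 * c j.+1 + c j.+2 = G j) ->
  (forall j, `|G j| <= G0) -> (forall j, `|G j.+1 - G j| <= G1) ->
  (forall j, `|(G j.+2 - G j.+1) - (G j.+1 - G j)| <= G2) ->
  forall j, `|c j| <= G0 + 2 * N%:R * G1 + N%:R ^+ 2 * G2.
Proof.
move=> oN per rec g0 g1 g2 j.
pose s j := c j + c j.+1.
have sper i : s (i + N)%N = s i by rewrite /s -addSn !per.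
have srec i : s i + s i.+1 = G i by rewrite -rec /s; ring.
have s0 := alternating_bound oN sper srec g0 g1.
pose t j := s j.+1 - s j.
have tper i : t (i + N)%N = t i by rewrite /t -addSn !sper.
have trec i : t i + t i.+1 = G i.+1 - G i by rewrite -!srec /t; ring.
have t0 := alternating_bound oN tper trec g1 g2.
apply: (le_trans (alternating_bound oN per (fun i => erefl (s i)) s0 t0 j)).
by rewrite le_eqVlt; apply/orP; left; apply/eqP; ring.
Qed.

Lemma normr_mxentry_le (R : realType) (n : nat) (v : 'cV[R]_n) (i : 'I_n) :
  `|v i 0| <= `|v|.
Proof. by rewrite {2}/Num.norm /= mx_normrE (le_trans _ (le_bigmax _ _ (i, 0))). Qed.

Lemma induced_norm_le (R : realType) (n : nat) (A : 'M[R]_n) (x : 'cV[R]_n) :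
  `|A *m x| <= induced_norm A * `|x| /\ 0 <= induced_norm A.
Proof.
pose S := [set `|A *m x| | x in [set x : 'cV[R]_n | `|x| <= 1]].
have hS : has_ubound S.
  (* The supremum is meaningful only once the set is known to be bounded; the sum of all entries in
     absolute value is a crude bound. *)
  exists (\sum_i \sum_j `|A i j|) => _ [v /= v1 <-].
  rewrite {1}/Num.norm /= mx_normrE; apply/bigmax_leP; split.
    by apply: sumr_ge0 => i _; apply: sumr_ge0.
  move=> [i z] _ /=; rewrite !mxE; apply: le_trans (ler_norm_sum _ _ _) _.
  apply: (@le_trans _ _ (\sum_j `|A i j|)).
    apply: ler_sum => j _; rewrite normrM -[leRHS]mulr1 ler_pM //.
    by rewrite (ord1 z) (le_trans (normr_mxentry_le v j)).
  rewrite [leRHS](bigD1 i) //= lerDl; apply: sumr_ge0 => ? _; apply: sumr_ge0 => //.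
have S0 : S 0 by exists 0; rewrite /= ?normr0 ?mulmx0 ?normr0.
have le_ind (v : 'cV[R]_n) : `|v| <= 1 -> `|A *m v| <= induced_norm A.
  by move=> v1; apply: ub_le_sup => //; exists v.
have ind0 : 0 <= induced_norm A by apply: ub_le_sup.
split => //; have [->|x0] := eqVneq x 0; first by rewrite mulmx0 !normr0 mulr0.
have nx : 0 < `|x| by rewrite normr_gt0.
have := le_ind (`|x|^-1 *: x).
rewrite -scalemxAr !normrZ !normfV !normr_id mulVf ?gt_eqF // => /(_ (lexx _)).
by rewrite ler_pdivrMl // mulrC.
Qed.

(* The rows of the adjugate of the trace matrix combine the two interface
   conditions; this eliminates the parameters from the Y column. *)
Lemma interface_combination (R : realType) (k h al be1 be2 s p q p' q' X Y : R) :
  h != 0 -> k != 0 ->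
  let Dm := - (p + q) in
  let Dp := X + s * (p' - q') in
  let Em := Y - ((k - 1) * k / 2 * p + k * (k + 1) / 2 * q) in
  let Ep := - (s * ((k - 1) * k / 2 * p' - k * (k + 1) / 2 * q')) in
  (1 / 2 - al) * Dp + (1 / 2 + al) * Dm + be2 * (2 / h * (Ep - Em)) = 0 ->
  2 / h * ((1 / 2 + al) * Ep + (1 / 2 - al) * Em) + be1 * (Dp - Dm) = 0 ->
  let T := al ^+ 2 + be1 * be2 + 1 / 4 in
  let L := - ((2 * k) / h) * (al ^+ 2 + be1 * be2 - 1 / 4) in
  let G := be1 + (k ^+ 2 * (k ^+ 2 - 1)) / h ^+ 2 * be2 - (2 * k ^+ 2) / h * T in
  let c := (2 * k * al) / h in
  let d1 := - be1 - (k ^+ 2 * (k ^+ 2 + 1)) / h ^+ 2 * be2 + (2 * k ^+ 2) / h * T in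
  let d2 := - ((2 * k ^+ 3) / h ^+ 2) * be2 + (2 * k) / h * T in
  let B := (1 / 2 - al) ^+ 2 + be1 * be2 in
  [/\ L * p + s * ((G + c) * p' + (d1 + d2) * q')
        = X * (- be1 + k * (k + 1) / h * B) + L * (2 / h * Y * (- (h / (2 * k)))),
      L * q + s * ((d1 - d2) * p' + (G - c) * q')
        = X * (be1 - k * (k - 1) / h * B) + L * (2 / h * Y * (h / (2 * k))) &
      G ^+ 2 - L ^+ 2 = c ^+ 2 + (d1 + d2) * (d1 - d2)].
Proof.
move=> h0 k0 Dm Dp Em Ep E1 E2 T L G c d1 d2 B; split.
- apply/eqP; rewrite -subr_eq0; apply/eqP.
  transitivity (- ((k * (k + 1) / h * (1 / 2 - al) - be1) *
      ((1 / 2 - al) * Dp + (1 / 2 + al) * Dm + be2 * (2 / h * (Ep - Em)))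
    + (k * (k + 1) / h * be2 - (1 / 2 + al)) *
      (2 / h * ((1 / 2 + al) * Ep + (1 / 2 - al) * Em) + be1 * (Dp - Dm)))).
    by rewrite /L /G /c /d1 /d2 /B /T /Dm /Dp /Em /Ep; field; rewrite h0.
  by rewrite E1 E2 !mulr0 addr0 oppr0.
- apply/eqP; rewrite -subr_eq0; apply/eqP.
  transitivity (- ((- (k * (k - 1) / h) * (1 / 2 - al) + be1) *
      ((1 / 2 - al) * Dp + (1 / 2 + al) * Dm + be2 * (2 / h * (Ep - Em)))
    + (- (k * (k - 1) / h) * be2 + (1 / 2 + al)) *
      (2 / h * ((1 / 2 + al) * Ep + (1 / 2 - al) * Em) + be1 * (Dp - Dm)))).
    by rewrite /L /G /c /d1 /d2 /B /T /Dm /Dp /Em /Ep; field; rewrite h0.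
  by rewrite E1 E2 !mulr0 addr0 oppr0.
- by rewrite /L /G /c /d1 /d2 /T; field.
Qed.

(* Multiplying 1 + (1 + Q) T, with T the shift, by 1 + (1 - Q) T leaves the
   scalar operator (1 + T)^2. *)
Lemma nilpotent_recursion_bound (R : realType) (n N : nat) (Q : 'M[R]_n)
    (c g : nat -> 'cV[R]_n) (qh g0 g1 g2 : R) :
  odd N -> (forall j, c (j + N)%N = c j) -> Q *m Q = 0 -> 0 <= qh ->
  (forall j, c j + c j.+1 + Q *m c j.+1 = g j) ->
  (forall v : 'cV[R]_n, `|Q *m v| <= qh * `|v|) ->
  (forall j, `|g j| <= g0) -> (forall j, `|g j.+1 - g j| <= g1) ->
  (forall j, `|(g j.+2 - g j.+1) - (g j.+1 - g j)| <= g2) ->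
  forall j i, `|c j i 0| <= (2 + qh) * (g0 + 2 * N%:R * g1 + N%:R ^+ 2 * g2).
Proof.
move=> oN per QQ qh0 rec Qle h0 h1 h2 j i.
pose G j := g j + g j.+1 - Q *m g j.+1.
have three (u v : 'cV[R]_n) b : `|u| <= b -> `|v| <= b ->
    `|(u + v - Q *m v) i 0| <= (2 + qh) * b.
  move=> ub vb; apply: le_trans (normr_mxentry_le _ _) _.
  apply: le_trans (ler_normB _ _) _; rewrite !mulrDl !mul1r lerD //.
    by apply: le_trans (ler_normD _ _) _; exact: lerD.
  by apply: le_trans (Qle v) _; rewrite ler_wpM2l.
have -> : (2 + qh) * (g0 + 2 * N%:R * g1 + N%:R ^+ 2 * g2)
  = (2 + qh) * g0 + 2 * N%:R * ((2 + qh) * g1) + N%:R ^+ 2 * ((2 + qh) * g2) by ring.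
apply: (@double_alternating_bound _ N (fun j => c j i 0) (fun j => G j i 0)) => //.
- by move=> l; rewrite per.
- move=> l; transitivity ((c l + (c l.+1 + c l.+1) + c l.+2) i 0).
    by rewrite !mxE; ring.
  congr (fun_of_matrix _ _ _).
  rewrite /G -!rec !mulmxDr mulmxA QQ mul0mx addr0.
  move: (Q *m c l.+1) (Q *m c l.+2) => a b.
  apply/matrixP => ? ?; rewrite !mxE.
  have alg (x y z r t : R) : x + (y + y) + z = x + y + r + (y + z + t) - (r + t) by ring.
  exact: alg.
- by move=> l; apply: three; exact: h0.
- move=> l; rewrite (_ : _ - _ = ((g l.+1 - g l) + (g l.+2 - g l.+1) - Q *m
      (g l.+2 - g l.+1)) i 0).
    by apply: three; exact: h1.
  rewrite /G mulmxBr; move: (Q *m g l.+2) (Q *m g l.+1) => a b; rewrite !mxE.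
  have alg (x y z r t : R) : y + z - r - (x + y - t) = (y - x) + (z - y) - (r - t) by ring.
  exact: alg.
- move=> l; set d := fun l => (g l.+2 - g l.+1) - (g l.+1 - g l).
  rewrite (_ : _ - _ = (d l + d l.+1 - Q *m d l.+1) i 0).
    by apply: three; exact: h2.
  rewrite /G /d !mulmxBr.
  move: (Q *m g l.+3) (Q *m g l.+2) (Q *m g l.+1) => a b e; rewrite !mxE.
  have alg (x y z t r1 r2 r3 : R) : z + t - r1 - (y + z - r2) - (y + z - r2 - (x + y - r3))
    = (z - y - (y - x)) + (t - z - (z - y)) - (r1 - r2 - (r2 - r3)) by ring.
  exact: alg.
Qed.

Definition col2 (R : realType) (x y : R) : 'cV[R]_2 := mx_of_rows 2 1 [:: [:: x]; [:: y]].

Lemma col2P (R : realType) (v w : 'cV[R]_2) :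
  v 0 0 = w 0 0 -> v 1 0 = w 1 0 -> v = w.
Proof.
move=> e0 e1; apply/matrixP => i j; rewrite (ord1 j).
case: i => [[|[|//]] hi].
- by rewrite (_ : Ordinal hi = 0) //; exact: val_inj.
- by rewrite (_ : Ordinal hi = 1) //; exact: val_inj.
Qed.

(** The parity condition says [Gm = (-1) ^+ k * L], hence [(-1) ^+ k / L = Gm^-1]. Dividing the
    combined interface relations by [L] therefore gives coefficient one to the next unknown, plus
    the nilpotent [Q]. *)
Lemma coefficient_bound (R : realType) (k N : nat) (h al be1 be2 : R)
    (p q X Y : nat -> R) (m0 m1 m2 : R) :
  let Gm := Gam k h al be1 be2 in
  let L := Lam k h al be1 be2 in
  (1 <= k)%N -> 0 < h -> odd N -> al ^+ 2 + be1 * be2 <> 1 / 4 ->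
  Gm = (if odd k then - L else L) ->
  (forall j, p (j + N)%N = p j) -> (forall j, q (j + N)%N = q j) ->
  (forall j,
    let Dm := - (p j + q j) in
    let Dp := X j.+1 + (-1) ^+ k * (p j.+1 - q j.+1) in
    let Em := Y j - ((k%:R - 1) * k%:R / 2 * p j + k%:R * (k%:R + 1) / 2 * q j) in
    let Ep := - ((-1) ^+ k * ((k%:R - 1) * k%:R / 2 * p j.+1 - k%:R * (k%:R + 1) / 2 * q
        j.+1)) in
    (1 / 2 - al) * Dp + (1 / 2 + al) * Dm + be2 * (2 / h * (Ep - Em)) = 0 /\
    2 / h * ((1 / 2 + al) * Ep + (1 / 2 - al) * Em) + be1 * (Dp - Dm) = 0) ->
  (forall j, `|X j| <= m0 /\ `|Y j| <= m0) ->
  (forall j, `|X j.+1 - X j| <= m1 /\ `|Y j.+1 - Y j| <= m1) ->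
  (forall j, `|(X j.+2 - X j.+1) - (X j.+1 - X j)| <= m2 /\
             `|(Y j.+2 - Y j.+1) - (Y j.+1 - Y j)| <= m2) ->
  forall j, let M := (2 + induced_norm (Q2 k h al be1 be2) / `|Gm|)
      * (`|V1 k h al be1 be2| + 2 * (h^-1 * `|V2 k h|))
      * (m0 + 2 * N%:R * m1 + N%:R ^+ 2 * m2) in
    `|p j| <= M /\ `|q j| <= M.
Proof.
move=> Gm L hk h0 oN ab GL perp perq E b0 b1' b2' j M.
have kn0 : k%:R != 0 :> R by rewrite pnatr_eq0 -lt0n.
have hn0 : h != 0 by rewrite gt_eqF.
have L0 : L != 0.
  rewrite /L /Lam mulf_neq0 //; last by rewrite subr_eq0; apply/eqP.
  by rewrite oppr_eq0 !mulf_neq0 ?invr_eq0 // pnatr_eq0.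
pose s : R := (-1) ^+ k.
have ss : s * s = 1 by rewrite /s -expr2 sqrr_sign.
have GsL : Gm = s * L by rewrite GL /s -signr_odd; case: odd; rewrite ?expr1 ?expr0; ring.
have G0 : Gm != 0 by rewrite GsL mulf_neq0 // signr_eq0.
have GiE : Gm^-1 = s / L by rewrite GsL invfM; congr (_ / _); rewrite /s -signr_odd;
    case: odd; rewrite ?expr1 ?expr0 ?invrN ?invr1.
pose Q : 'M[R]_2 := Gm^-1 *: Q2 k h al be1 be2.
pose c j := col2 (p j) (q j).
pose g j := X j.+1 *: V1 k h al be1 be2 + (2 / h * Y j) *: V2 k h.
have IC l := interface_combination hn0 kn0 (proj1 (E l)) (proj2 (E l)).
have QQ : Q *m Q = 0.
  have [_ _ H] := IC 0%N.
  have {}H : c2 k h al ^+ 2 + (b1 k h al be1 be2 + b2 k h al be1 be2) *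
      (b1 k h al be1 be2 - b2 k h al be1 be2) = 0.
    by rewrite -[LHS]H -/(Gam k h al be1 be2) -/(Lam k h al be1 be2) -/Gm -/L GsL exprMn
        expr2 ss mul1r subrr.
  rewrite /Q -scalemxAl -scalemxAr /Q2; move: H.
  move: (c2 _ _ _) (b1 _ _ _ _ _ + b2 _ _ _ _ _) (b1 _ _ _ _ _ - b2 _ _ _ _ _) =>
      cc dp dm H.
  rewrite (_ : _ *m _ = 0) ?scaler0 //.
  apply/matrixP => i l; rewrite !mxE !big_ord_recl big_ord0 !mxE /=.
  case: i => [[|[|//]] hi]; case: l => [[|[|//]] hl] /=; rewrite ?addr0.
  + by rewrite -[RHS]H; ring.
  + by ring.
  + by ring.
  + by rewrite -[RHS]H; ring.
have algL P P' Q' cc e : L * (P + P' + (Gm^-1 * cc * P' + Gm^-1 * e * Q'))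
    = L * P + s * ((Gm + cc) * P' + e * Q').
  rewrite GiE GsL; transitivity (L * P + s * s * L * P' + s * cc * P' + s * e * Q'); last
      by ring.
  by rewrite ss mul1r; field.
have algR x t y v : L * (x * (L^-1 * t) + y * v) = x * t + L * (y * v) by field.
have rec l : c l + c l.+1 + Q *m c l.+1 = g l.
  have [H1 H2 _] := IC l.
  apply: col2P.
  - rewrite /c /g /Q /Q2 /V1 /V2 !mxE !big_ord_recl big_ord0 !mxE /= addr0.
    by apply: (mulfI L0); rewrite algL algR; exact: H1.
  - rewrite /c /g /Q /Q2 /V1 /V2 !mxE !big_ord_recl big_ord0 !mxE /= addr0.
    apply: (mulfI L0); rewrite algR; apply: etrans H2.
    rewrite [X in L * (_ + _ + X)]addrC
        [X in L * (_ + _ + (X + _))](_ : _ = Gm^-1 * (- c2 k h al) * q l.+1) //.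
    by rewrite algL [X in _ + s * X]addrC.
pose W := `|V1 k h al be1 be2| + 2 * (h^-1 * `|V2 k h|).
have gW (x y m : R) : `|x| <= m -> `|y| <= m ->
    `|x *: V1 k h al be1 be2 + (2 / h * y) *: V2 k h| <= W * m.
  move=> xm ym; apply: le_trans (ler_normD _ _) _.
  have e : `|2 / h * y| = 2 / h * `|y| by rewrite normrM ger0_norm // divr_ge0 // ltW.
  rewrite (normrZ x) (normrZ (2 / h * y)) e /W [leRHS]mulrDl lerD //.
    by rewrite mulrC ler_wpM2l.
  have -> : 2 / h * `|y| * `|V2 k h| = 2 * (h^-1 * `|V2 k h|) * `|y| by ring.
  by rewrite ler_wpM2l // !mulr_ge0 // invr_ge0 ltW.
have Qle (v : 'cV[R]_2) : `|Q *m v| <= induced_norm (Q2 k h al be1 be2) / `|Gm| * `|v|.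
  rewrite /Q -scalemxAl normrZ normfV mulrAC mulrC ler_wpM2r ?invr_ge0 //.
  by have [] := induced_norm_le (Q2 k h al be1 be2) v.
have qh0 : 0 <= induced_norm (Q2 k h al be1 be2) / `|Gm|.
  by rewrite mulr_ge0 ?invr_ge0 //; have [] := induced_norm_le (Q2 k h al be1 be2) 0.
have cper l : c (l + N)%N = c l by rewrite /c perp perq.
have gd0 l : `|g l| <= W * m0.
  by have [? _] := b0 l.+1; have [_ ?] := b0 l; exact: gW.
have gd1 l : `|g l.+1 - g l| <= W * m1.
  have -> : g l.+1 - g l = (X l.+2 - X l.+1) *: V1 k h al be1 be2 +
      (2 / h * (Y l.+1 - Y l)) *: V2 k h.
    by rewrite /g; apply/matrixP => ? ?; rewrite !mxE; ring.
  by have [? _] := b1' l.+1; have [_ ?] := b1' l; exact: gW.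
have gd2 l : `|(g l.+2 - g l.+1) - (g l.+1 - g l)| <= W * m2.
  have -> : (g l.+2 - g l.+1) - (g l.+1 - g l) = ((X l.+3 - X l.+2) - (X l.+2 - X l.+1))
      *: V1 k h al be1 be2
      + (2 / h * ((Y l.+2 - Y l.+1) - (Y l.+1 - Y l))) *: V2 k h.
    by rewrite /g; apply/matrixP => ? ?; rewrite !mxE; ring.
  by have [? _] := b2' l.+1; have [_ ?] := b2' l; exact: gW.
have H := nilpotent_recursion_bound oN cper QQ qh0 rec Qle gd0 gd1 gd2 j.
have ME : M = (2 + induced_norm (Q2 k h al be1 be2) / `|Gm|)
    * (W * m0 + 2 * N%:R * (W * m1) + N%:R ^+ 2 * (W * m2)) by rewrite /M -/W; ring.
rewrite ME; split.
- by have := H 0; rewrite !mxE.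
- by have := H 1; rewrite !mxE.
Qed.

(** * Integrals, traces and norms of cellwise polynomials *)

Lemma Rintegral_affine (R : realType) (g : R -> R) (m s : R) : continuous g -> 0 < s ->
  s * \int[leb R]_(x in `[-1, 1]) g (m + s * (x + 1)) =
  \int[leb R]_(x in `[m, m + 2 * s]) g x.
Proof.
move=> cg s0.
have [P HP] := primitive_exists (fun c d => continuous_segment_integrable c d cg).
have dP := is_derive_of_integral cg HP.
have cg' : continuous (fun x : R => s * g (m + s * (x + 1))).
  move=> x; apply: cvgM; first exact: cvg_cst.
  apply: (@continuous_comp _ _ _ (fun x : R => m + s * (x + 1)) g); last exact: cg.
  apply: cvgD; first exact: cvg_cst.
  by apply: cvgM; [exact: cvg_cst|apply: cvgD; [exact: cvg_id|exact: cvg_cst]].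
have cg'' : continuous (fun x : R => g (m + s * (x + 1))).
  move=> x; apply: (@continuous_comp _ _ _ (fun x : R => m + s * (x + 1)) g);
      last exact: cg.
  apply: cvgD; first exact: cvg_cst.
  by apply: cvgM; [exact: cvg_cst|apply: cvgD; [exact: cvg_id|exact: cvg_cst]].
rewrite -RintegralZl //; last exact: continuous_segment_integrable.
have D (x : R) : is_derive x 1 (P \o (fun x : R => m + s * (x + 1)))
    (s * g (m + s * (x + 1))).
  rewrite mulrC; apply: is_derive1_comp.
  by apply: is_derive_eq; rewrite /GRing.scale /=; ring.
have m11 : (-1 : R) < 1 by lra.
rewrite (Rintegral_FTC m11 cg' D) /= -HP; last lra.
by congr (P _ - P _); ring.
Qed.

Lemma lim_at_left_eq (R : realType) (f g : R -> R) (c d : R) : c < d ->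
  (forall x, c < x < d -> f x = g x) -> {for d, continuous g} ->
  lim (f x @[x --> d^'-]) = g d.
Proof.
move=> cd fg cg; apply: cvg_lim => //.
have : g x @[x --> d^'-] --> g d by apply: cvg_at_left_filter.
apply: cvg_trans; apply: near_eq_cvg; near=> x; rewrite fg //.
by apply/andP; split; near: x; [exact: nbhs_left_gt|exact: nbhs_left_lt].
Unshelve. all: by end_near. Qed.

Lemma lim_at_right_eq (R : realType) (f g : R -> R) (c d : R) : c < d ->
  (forall x, c < x < d -> f x = g x) -> {for c, continuous g} ->
  lim (f x @[x --> c^'+]) = g c.
Proof.
move=> cd fg cg; apply: cvg_lim => //.
have : g x @[x --> c^'+] --> g c by apply: cvg_at_right_filter.
apply: cvg_trans; apply: near_eq_cvg; near=> x; rewrite fg //.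
by apply/andP; split; near: x; [exact: nbhs_right_gt|exact: nbhs_right_lt].
Unshelve. all: by end_near. Qed.

Lemma derive1_eq_poly (R : realType) (f : R -> R) (q : {poly R}) (c d : R) :
  (forall x, c < x < d -> f x = q.[x]) ->
  forall x, c < x < d -> derive1 f x = q^`().[x].
Proof.
move=> fq x /andP[cx xd].
have H : \forall y \near x, q.[y] = f y.
  near=> y; rewrite fq //; apply/andP; split; near: y; [exact: lt_nbhsr|exact: lt_nbhsl].
have D := near_eq_is_derive H (is_derive_poly q x).
by rewrite derive1E (@derive_val _ _ _ _ _ _ _ D).
Unshelve. all: by end_near. Qed.

Lemma ae_cofinite (R : realType) (s : seq R) : {ae leb R, forall x, x \notin s}.
Proof.
exists [set` s]; split.
- exact: countable_measurable (finite_set_countable (finite_seq s)).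
- exact: countable_lebesgue_measure0 (finite_set_countable (finite_seq s)).
- by move=> x /= /negP; rewrite negbK.
Qed.

(** One constant serves both exponents: the factor is 1 for the supremum norm and [sqrt (b - a)] for
    the L^2 norm, and [1 + (b - a)] dominates both. *)
Lemma LpNorm_le (R : realType) (a b B : R) (p : \bar R) (f : R -> R) : a < b -> 0 <= B ->
  p = 2%:E \/ p = +oo%E ->
  measurable_fun `[a, b] (f : measurableTypeR R -> R) ->
  {ae leb R, forall x, a <= x <= b -> `|f x| <= B} ->
  (LpNorm p `[a, b] f <= ((1 + (b - a)) * B)%:E)%E.
Proof.
move=> ab B0 hp mf fB.
have L0 : 0 < b - a by lra.
have ae' : {ae leb R, forall x, `|(f \_ `[a, b]) x| <= B * (a <= x <= b)%R%:R}.
  apply: (@filterS _ _ (ae_filter_ringOfSetsType (leb R)) _ _ _ fB) => x H.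
  rewrite patchE mem_setE in_itv /=; case: (boolP (a <= x <= b)) => xab.
    by rewrite mulr1 H.
  by rewrite normr0 mulr0.
rewrite /LpNorm unlock; case: hp => -> /=; last first.
  rewrite leb_setT_gt0; apply/ess_supP.
  apply: (@filterS _ _ (ae_filter_ringOfSetsType (leb R)) _ _ _ ae') => x /= H.
  rewrite lee_fin (le_trans H) //; case: (a <= x <= b) => /=; nra.
have mfp : measurable_fun [set: measurableTypeR R] (f \_ `[a, b]).
  exact: (proj1 (measurable_restrictT _ _) mf).
have I2 : (\int[leb R]_x (`|((f \_ `[a, b]) x)%:E| `^ 2) <= (B ^+ 2 * (b - a))%:E)%E.
  have -> : ((B ^+ 2 * (b - a))%:E = \int[leb R]_(x in `[a, b]) (B ^+ 2)%:E)%E.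
    by rewrite integral_cst //= /leb lebesgue_measure_itv /= lte_fin ab -EFinD -EFinM.
  rewrite [leRHS]integral_mkcond.
  apply: ae_ge0_le_integral => //.
  - by move=> x _; exact: poweR_ge0.
  - apply: (@measurableT_comp _ _ _ _ _ _ (fun x => x `^ 2)%E);
        first exact: measurable_poweR.
    by apply: measurableT_comp => //; exact/measurable_EFinP.
  - by move=> x _; rewrite erestrict_ge0 // => ? _; rewrite lee_fin sqr_ge0.
  - have mD : measurable (`[a, b]%classic : set (measurableTypeR R))
        by exact: measurable_itv.
    exact: (proj1 (measurable_restrictT _ mD) (measurable_cst _)).
  - apply: (@filterS _ _ (ae_filter_ringOfSetsType (leb R)) _ _ _ ae') => x H _.
    rewrite [X in (_ <= X)%E]patchE mem_setE in_itv /= ?poweR_EFin powR_mulrn //.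
    move: H; case: (a <= x <= b) => /=; rewrite lee_fin => H.
      by rewrite lerXn2r ?nnegrE // -[B]mulr1.
    rewrite mulr0 in H; have e : `|(f \_ `[a, b]) x| = 0 by apply/eqP;
        rewrite eq_le H normr_ge0.
    by rewrite e expr0n.
apply: (@le_trans _ _ ((B ^+ 2 * (b - a))%:E `^ 2^-1)%E).
  apply: gt0_ler_poweR => //.
  - by rewrite in_itv /= leey andbT; apply: integral_ge0 => x _; rewrite lee_fin powR_ge0.
  - by rewrite in_itv /= leey andbT lee_fin mulr_ge0 ?sqr_ge0 // ltW.
have BL : 0 <= B ^+ 2 * (b - a) by rewrite mulr_ge0 ?sqr_ge0 // ltW.
rewrite poweR_EFin lee_fin powR12_sqrt //.
have rhs0 : 0 <= (1 + (b - a)) * B by rewrite mulr_ge0 //; lra.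
rewrite -[leRHS](ger0_norm rhs0) -sqrtr_sqr ler_wsqrtr //.
by rewrite exprMn mulrC ler_wpM2r ?sqr_ge0 //; nra.
Qed.

(** * The error estimate on the reference cell *)

Lemma legendre_endpoints (R : realType) (k : nat) : (1 <= k)%N ->
  let K : R := k%:R in let s : R := (-1) ^+ k in
  [/\ (legendre R k.-1).[1] = 1, (legendre R k).[1] = 1,
      (legendre R k.-1).[-1] = - s & (legendre R k).[-1] = s] /\
  [/\ (legendre R k.-1)^`().[1] = (K - 1) * K / 2, (legendre R k)^`().[1] = K * (K + 1) / 2,
      (legendre R k.-1)^`().[-1] = s * ((K - 1) * K / 2) &
      (legendre R k)^`().[-1] = - (s * (K * (K + 1) / 2))].
Proof.
case: k => // k _ /=.
have s1 : (1 : R) ^+ 2 = 1 by rewrite expr1n.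
have sm : (-1 : R) ^+ 2 = 1 by rewrite sqrrN expr1n.
have [a1 c1] := horner_legendre k s1.
have [a2 c2] := horner_legendre k.+1 s1.
have [b1 d1] := horner_legendre k sm.
have [b2 d2] := horner_legendre k.+1 sm.
rewrite a1 a2 b1 b2 c1 c2 d1 d2 !expr1n.
have e1 : k.+1%:R = k%:R + 1 :> R by rewrite natr1.
have e2 : k.+2%:R = k%:R + 1 + 1 :> R by rewrite !natr1.
rewrite !exprS e1 e2; split; split; ring.
Qed.

Lemma poly_bounded (R : realType) (p : {poly R}) :
  exists2 S : R, 0 <= S & forall x, -1 <= x <= 1 -> `|p.[x]| <= S.
Proof.
exists (\sum_(i < size p) `|p`_i|); first exact: sumr_ge0.
move=> x xI; rewrite horner_coef; apply: le_trans (ler_norm_sum _ _ _) _.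
apply: ler_sum => i _; rewrite normrM normrX -[leRHS]mulr1 ler_pM //.
by rewrite exprn_ile1 // ler_norml.
Qed.

(** All cells are pulled back to [[-1, 1]], so physical slopes carry the factor [2 / h]. [Dm], [Dp],
    [Em], [Ep] are the left and right traces of the error and of its reference slope; the hypothesis
    on them says that both flux combinations of the error vanish at each interface. *)
Lemma reference_estimate (R : realType) (k : nat) : (1 <= k)%N ->
  exists2 C : R, 0 <= C & forall (N : nat) (h al be1 be2 : R)
    (v : nat -> nat -> R -> R) (w : nat -> {poly R}) (m0 m1 m2 : R),
  let Gm := Gam k h al be1 be2 in
  let L := Lam k h al be1 be2 in
  0 < h -> odd N -> al ^+ 2 + be1 * be2 <> 1 / 4 ->
  Gm = (if odd k then - L else L) ->
  (forall j i x, (i <= 1)%N -> v (j + N)%N i x = v j i x) ->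
  (forall j, w (j + N)%N = w j) ->
  (forall j i, (i <= k)%N -> forall x : R, is_derive x 1 (v j i) (v j i.+1 x)) ->
  (forall j, (size (w j) <= k.+1)%N) ->
  (forall j (q : {poly R}), (size q <= k.-1)%N ->
     \int[leb R]_(x in `[-1, 1]) ((v j 0%N x - (w j).[x]) * q.[x]) = 0) ->
  (forall j,
    let Dm := v j 0%N 1 - (w j).[1] in
    let Dp := v j.+1 0%N (-1) - (w j.+1).[-1] in
    let Em := v j 1%N 1 - (w j)^`().[1] in
    let Ep := v j.+1 1%N (-1) - (w j.+1)^`().[-1] in
    (1 / 2 - al) * Dp + (1 / 2 + al) * Dm + be2 * (2 / h * (Ep - Em)) = 0 /\
    2 / h * ((1 / 2 + al) * Ep + (1 / 2 - al) * Em) + be1 * (Dp - Dm) = 0) ->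
  (forall j x, -1 <= x <= 1 -> `|v j k.+1 x| <= m0) ->
  (forall j x, -1 <= x <= 1 -> `|v j.+1 k.+1 x - v j k.+1 x| <= m1) ->
  (forall j x, -1 <= x <= 1 ->
    `|(v j.+2 k.+1 x - v j.+1 k.+1 x) - (v j.+1 k.+1 x - v j k.+1 x)| <= m2) ->
  forall j x, -1 <= x <= 1 -> `|v j 0%N x - (w j).[x]|
    <= C * (m0 + (2 + induced_norm (Q2 k h al be1 be2) / `|Gm|)
      * (`|V1 k h al be1 be2| + 2 * (h^-1 * `|V2 k h|))
      * (m0 + 2 * N%:R * m1 + N%:R ^+ 2 * m2)).
Proof.
move=> hk; have [C C0 HC] := local_projection_error R hk.
have [S1 S10 HS1] := poly_bounded (legendre R k.-1).
have [S2 S20 HS2] := poly_bounded (legendre R k).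
exists (C * (1 + S1 + S2)); first by rewrite mulr_ge0 // !addr_ge0.
move=> N h al be1 be2 v w m0 m1 m2 Gm L h0 oN nd GL vper wper dv sw mom ifc b0 b1 b2 j x xI.
have [] := legendre_endpoints R hk.
set s : R := (-1) ^+ k; move=> [l1 l2 l3 l4] [l5 l6 l7 l8].
have kn0 : k%:R != 0 :> R by rewrite pnatr_eq0 -lt0n.
have ss : s * s = 1 by rewrite /s -expr2 sqrr_sign.
pose d l := (w l).[1] - v l 0%N 1.
pose e l := (w l)^`().[-1] - v l 1%N (-1).
(* [p] and [q] solve [p + q = d] together with the slope equation at -1, a system of determinant
   [k ^ 2] up to sign. Correcting [w] by them produces the local projection [W], so its existence
   needs no separate argument. *)
pose p l := (s * e l + k%:R * (k%:R + 1) / 2 * d l) / k%:R ^+ 2.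
pose q l := d l - p l.
pose W l := w l - (p l *: legendre R k.-1 + q l *: legendre R k).
have WE l y : (W l).[y] = (w l).[y] -
    (p l * (legendre R k.-1).[y] + q l * (legendre R k).[y]).
  by rewrite /W hornerD hornerN hornerD (hornerZ (p l)) (hornerZ (q l)).
have dWE l y : (W l)^`().[y] = (w l)^`().[y] -
    (p l * (legendre R k.-1)^`().[y] + q l * (legendre R k)^`().[y]).
  by rewrite /W derivB derivD (derivZ (p l)) (derivZ (q l)) hornerD hornerN hornerD
      (hornerZ (p l)) (hornerZ (q l)).
have lp l : local_projection k (v l) (W l).
  split.
  - exact: dv.
  - rewrite /W (leq_trans (size_polyD _ _)) // geq_max sw size_polyN /=.
    have [z1 _] := coef_legendre R k.-1; have [z2 _] := coef_legendre R k.
    rewrite (leq_trans (size_polyD _ _)) // geq_max.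
    rewrite (leq_trans (size_scale_leq (p l) _)) ?(leq_trans (size_scale_leq (q l) _)) //.
    by rewrite (leq_trans z1) // prednK // ltnW.
  - move=> r sr.
    have cl c n : (leb R).-integrable `[-1, 1]
        (EFin \o (fun y => c * ((legendre R n).[y] * r.[y]))).
      apply: continuous_segment_integrable => y; apply: cvgM; first exact: cvg_cst.
      by apply: continuous_hornerM; exact: continuous_horner.
    have cl' n : (leb R).-integrable `[-1, 1]
        (EFin \o (fun y => (legendre R n).[y] * r.[y])).
      by apply: continuous_segment_integrable; apply: continuous_hornerM;
          exact: continuous_horner.
    have cv : (leb R).-integrable `[-1, 1]
        (EFin \o (fun y => (v l 0%N y - (w l).[y]) * r.[y])).
      apply: continuous_segment_integrable; apply: continuous_hornerM => y.
      by apply: cvgB; [exact: is_derive_continuous (dv l 0%N isT y)|exact: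
          continuous_horner].
    have cs : (leb R).-integrable `[-1, 1]
        (EFin \o (fun y => p l * ((legendre R k.-1).[y] * r.[y]) + q l *
        ((legendre R k).[y] * r.[y]))).
      apply: continuous_segment_integrable => y; apply: cvgD;
          (apply: cvgM; first exact: cvg_cst);
        by apply: continuous_hornerM; exact: continuous_horner.
    transitivity (\int[leb R]_(y in `[-1, 1]) ((v l 0%N y - (w l).[y]) * r.[y]
        + (p l * ((legendre R k.-1).[y] * r.[y]) + q l * ((legendre R k).[y] * r.[y])))).
      by apply: eq_Rintegral => y _; rewrite WE; ring.
    rewrite RintegralD // mom // add0r RintegralD // !RintegralZl //.
    rewrite !legendre_orthogonal // ?mulr0 ?addr0 //.
    by rewrite (leq_trans sr) // leq_pred.
  - by rewrite WE l1 l2 /q /d; ring.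
  - rewrite dWE l7 l8.
    transitivity ((w l)^`().[-1] - (s * k%:R ^+ 2 * p l - s * (k%:R * (k%:R + 1) / 2) * d
        l)); last by rewrite /q; field.
    rewrite {1}/p; transitivity ((w l)^`().[-1] - s * s * e l); first by rewrite ss /e;
        ring.
    by field.
have b1' l y : -1 <= y <= 1 -> `|v l.+1 k.+1 y - v l k.+1 y| <= m1 by exact: b1.
pose X l := v l 0%N (-1) - (W l).[-1].
pose Y l := v l 1%N 1 - (W l)^`().[1].
have i1 : -1 <= (1 : R) <= 1 by lra.
have i2 : -1 <= (-1 : R) <= 1 by lra.
have c0 l : `|X l| <= C * m0 /\ `|Y l| <= C * m0.
  split; first by have [] := HC _ _ _ (lp l) (b0 l) (-1) i2.
  by have [] := HC _ _ _ (lp l) (b0 l) 1 i1.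
have lp1 l := local_projectionB (lp l.+1) (lp l).
have c1 l : `|X l.+1 - X l| <= C * m1 /\ `|Y l.+1 - Y l| <= C * m1.
  split.
  - have [+ _] := HC _ _ _ (lp1 l) (b1 l) (-1) i2.
    by congr (`|_| <= _); rewrite hornerD hornerN /X; ring.
  - have [_] := HC _ _ _ (lp1 l) (b1 l) 1 i1.
    by congr (`|_| <= _); rewrite derivB hornerD hornerN /Y; ring.
have hB (r t : {poly R}) y : (r - t).[y] = r.[y] - t.[y] by rewrite hornerD hornerN.
have lp2 l := local_projectionB (lp1 l.+1) (lp1 l).
have c2 l : `|(X l.+2 - X l.+1) - (X l.+1 - X l)| <= C * m2 /\
            `|(Y l.+2 - Y l.+1) - (Y l.+1 - Y l)| <= C * m2.
  split.
  - have [+ _] := HC _ _ _ (lp2 l) (b2 l) (-1) i2.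
    by congr (`|_| <= _); rewrite hB (hB (W l.+2)) (hB (W l.+1)) /X; ring.
  - have [_] := HC _ _ _ (lp2 l) (b2 l) 1 i1.
    by congr (`|_| <= _); rewrite derivB (derivB (W l.+2)) (derivB (W l.+1)) hB
        (hB (W l.+2)^`()) (hB (W l.+1)^`()) /Y; ring.
have pper l : p (l + N)%N = p l by rewrite /p /d /e wper !vper.
have qper l : q (l + N)%N = q l by rewrite /q pper /d wper !vper.
have ifc' l :
    let Dm := - (p l + q l) in
    let Dp := X l.+1 + s * (p l.+1 - q l.+1) in
    let Em := Y l - ((k%:R - 1) * k%:R / 2 * p l + k%:R * (k%:R + 1) / 2 * q l) in
    let Ep := - (s * ((k%:R - 1) * k%:R / 2 * p l.+1 - k%:R * (k%:R + 1) / 2 * q l.+1)) in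
    (1 / 2 - al) * Dp + (1 / 2 + al) * Dm + be2 * (2 / h * (Ep - Em)) = 0 /\
    2 / h * ((1 / 2 + al) * Ep + (1 / 2 - al) * Em) + be1 * (Dp - Dm) = 0.
  have := ifc l.
  have -> : v l 0%N 1 - (w l).[1] = - (p l + q l) by rewrite /q /d; ring.
  have -> : v l.+1 0%N (-1) - (w l.+1).[-1] = X l.+1 + s * (p l.+1 - q l.+1).
    by rewrite /X WE l3 l4; ring.
  have -> : v l 1%N 1 - (w l)^`().[1]
      = Y l - ((k%:R - 1) * k%:R / 2 * p l + k%:R * (k%:R + 1) / 2 * q l).
    by rewrite /Y dWE l5 l6; ring.
  have -> : v l.+1 1%N (-1) - (w l.+1)^`().[-1] =
      - (s * ((k%:R - 1) * k%:R / 2 * p l.+1 - k%:R * (k%:R + 1) / 2 * q l.+1)).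
    by have [_ _ _ _ ->] := lp l.+1; rewrite dWE l7 l8; ring.
  by [].
have [pb qb] := coefficient_bound hk h0 oN nd GL pper qper ifc' c0 c1 c2 j.
have -> : v j 0%N x - (w j).[x] = (v j 0%N x - (W j).[x])
    - (p j * (legendre R k.-1).[x] + q j * (legendre R k).[x]) by rewrite WE; ring.
set Mc := (2 + _) * _ * _ in pb qb.
have e1 : `|p j * (legendre R k.-1).[x]| <= Mc * S1 by rewrite normrM ler_pM // HS1.
have e2 : `|q j * (legendre R k).[x]| <= Mc * S2 by rewrite normrM ler_pM // HS2.
have [e3 _] := HC _ _ _ (lp j) (b0 j) x xI.
set Mt := (2 + _) * _ * _.
have MM : Mc = C * Mt by rewrite /Mc /Mt; ring.
have m00 : 0 <= m0 by apply: le_trans (b0 0%N 1 i1).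
have Mt0 : 0 <= C * Mt by rewrite -MM; apply: le_trans pb.
rewrite MM in e1 e2.
have f1 : 0 <= C * m0 * (S1 + S2) by rewrite !mulr_ge0 // addr_ge0.
apply: le_trans (ler_normB _ _) _; apply: le_trans (lerD e3 (ler_normD _ _)) _.
apply: le_trans (lerD (lexx _) (lerD e1 e2)) _.
have -> : C * (1 + S1 + S2) * (m0 + Mt) = C * m0 + (C * Mt * S1 + C * Mt * S2) + C * m0 *
    (S1 + S2) + C * Mt by ring.
lra.
Qed.

(** * Transfer to the physical mesh *)

Lemma difference_bound (R : realType) (f df : R -> R) (h M : R) : 0 <= h ->
  (forall x : R, is_derive x 1 f (df x)) -> (forall x, `|df x| <= M) ->
  forall x, `|f (x + h) - f x| <= h * M.
Proof.
move=> h0 dfx dM x; have xh : x <= x + h by lra.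
have [c _ ->] := MVT_segment xh (fun y _ => dfx y)
  (continuous_subspaceT (fun y => is_derive_continuous (dfx y))).
have -> : x + h - x = h by ring.
by rewrite normrM (ger0_norm h0) mulrC ler_wpM2l.
Qed.

Lemma second_difference_bound (R : realType) (f df ddf : R -> R) (h M : R) : 0 <= h ->
  (forall x : R, is_derive x 1 f (df x)) -> (forall x : R, is_derive x 1 df (ddf x)) ->
  (forall x, `|ddf x| <= M) ->
  forall x, `|(f (x + h + h) - f (x + h)) - (f (x + h) - f x)| <= h * (h * M).
Proof.
move=> h0 d1 d2 dM x.
have D (y : R) : is_derive y 1 (fun y => f (y + h) - f y) (df (y + h) - df y).
  have D1 : is_derive y 1 (f \o (fun y => y + h)) (df (y + h) * 1).
    by apply: is_derive1_comp; apply: is_derive_eq; rewrite ?addr0.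
  rewrite mulr1 in D1; have D2 := d1 y.
  exact: (is_deriveB D1 D2).
by apply: (difference_bound h0 D) => y; exact: (difference_bound h0 d2 dM).
Qed.

(** Maps [[-1, 1]] onto the cell with left end [m] and half-width [s]. *)
Definition affine (R : realType) (m s : R) : {poly R} := s *: ('X + 1) + m%:P.

Lemma horner_affine (R : realType) (q : {poly R}) (m s x : R) :
  (q \Po affine m s).[x] = q.[m + s * (x + 1)].
Proof. by rewrite horner_comp /affine !hornerE addrC. Qed.

Lemma horner_affine_deriv (R : realType) (q : {poly R}) (m s x : R) :
  (q \Po affine m s)^`().[x] = s * q^`().[m + s * (x + 1)].
Proof.
rewrite deriv_comp hornerM horner_affine mulrC /affine.
by rewrite derivD derivZ derivD derivX derivC -polyC1 derivC !(hornerD, hornerZ, hornerC)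
    !addr0 mulr1.
Qed.

Lemma size_affine_comp (R : realType) (q : {poly R}) (m s : R) :
  (size (q \Po affine m s) <= size q)%N.
Proof.
have [->|q0] := eqVneq q 0; first by rewrite comp_poly0.
have [->|c0] := eqVneq (q \Po affine m s) 0; first by rewrite size_poly0.
have sa : (size (affine m s) <= 2)%N.
  rewrite /affine (leq_trans (size_polyD _ _)) // geq_max.
  have sX : size ('X + 1 : {poly R}) = 2%N by rewrite -polyC1 size_XaddC.
  by rewrite (leq_trans (size_scale_leq _ _)) ?sX // (leq_trans (size_polyC_leq1 _)).
have := size_comp_poly_leq q (affine m s).
have : ((size q).-1 * (size (affine m s)).-1 <= (size q).-1)%N.
  by rewrite -[leqRHS]muln1 leq_mul //; case: (size (affine m s)) sa => [|[|[|]]].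
move=> H1 H2; apply: (leq_trans H2); rewrite -(prednK (n := size q)) ?ltnS //.
by rewrite lt0n size_poly_eq0.
Qed.

(** The 4 comes from [2 + q <= 2 * (1 + q)] and [n1 + 2 * n2 <= 2 * (n1 + n2)]. [S] and [H] stand
    for the powers of [h / 2] and of [h] times the norm of the data, and [B] for the square of one
    plus the length of the interval. *)
Lemma absorb_constants (R : realType) (C S H B q n1 n2 : R) :
  0 <= C -> 0 <= S -> S <= H -> 1 <= B -> 0 <= q -> 0 <= n1 -> 0 <= n2 ->
  C * (S + (2 + q) * (n1 + 2 * n2) * (S * B))
    <= C * (4 * B) * H * (1 + (1 + q) * (n1 + n2)).
Proof.
move=> C0 S0 SH B1 q0 n10 n20.
set Z := (1 + q) * (n1 + n2).
have Z0 : 0 <= Z by rewrite /Z mulr_ge0 //; lra.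
have ZZ : (2 + q) * (n1 + 2 * n2) <= 4 * Z.
  have ? : 0 <= q * n1 by exact: mulr_ge0.
  have ? : 0 <= q * n2 by exact: mulr_ge0.
  by rewrite /Z; nra.
have -> : C * (4 * B) * H * (1 + Z) = C * (4 * B * H * (1 + Z)) by ring.
rewrite ler_wpM2l //.
have SB0 : 0 <= S * B by rewrite mulr_ge0 //; lra.
have SB : S <= S * B by rewrite ler_peMr.
have HB : S * B <= H * B by rewrite ler_wpM2r //; lra.
have e1 : (2 + q) * (n1 + 2 * n2) * (S * B) <= 4 * Z * (S * B) by rewrite ler_wpM2r.
have e2 : S * B * (1 + Z) <= H * B * (1 + Z) by rewrite ler_wpM2r //; lra.
nra.
Qed.

Lemma pointwise_error (R : realType) (k : nat) (a b : R) : (1 <= k)%N -> a < b ->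
  exists2 C : R, 0 <= C & forall (N : nat) (al be1 be2 : R) (F : nat -> R -> R)
    (w : R -> R) (M : R),
  let h := mesh_size a b N in
  let Gm := Gam k h al be1 be2 in
  let L := Lam k h al be1 be2 in
  odd N -> al ^+ 2 + be1 * be2 <> 1 / 4 ->
  Gm = (if odd k then - L else L) ->
  (forall i, (i < k + 3)%N -> forall x : R, is_derive x 1 (F i) (F i.+1 x)) ->
  (forall i x, (i <= k + 3)%N -> F i (x + (b - a)) = F i x) ->
  (forall i x, (i <= k + 3)%N -> `|F i x| <= M) ->
  is_Phstar a b N k al be1 be2 (F 0%N) w ->
  forall j x, (j < N)%N -> mesh_node a b N j < x < mesh_node a b N j.+1 ->
  `|w x - F 0%N x| <= C * h ^+ k.+1 * M
    * (1 + (1 + induced_norm (Q2 k h al be1 be2) / `|Gm|)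
           * (`|V1 k h al be1 be2| + h^-1 * `|V2 k h|)).
Proof.
move=> hk ab; have [C C0 HC] := reference_estimate R hk.
pose ell := b - a.
have ell0 : 0 < ell by rewrite /ell; lra.
exists (C * (4 * (1 + ell) ^+ 2)).
  by rewrite mulr_ge0 // mulr_ge0 // sqr_ge0.
move=> N al be1 be2 F w M h Gm L oN nd GL dF perF FM [wV wmom wi1 wi2] j x jN xj.
have N0 : (0 < N)%N by case: (N) oN.
have NR : 0 < N%:R :> R by rewrite ltr0n.
have h0 : 0 < h by rewrite /h /mesh_size divr_gt0.
have Nh : N%:R * h = ell by rewrite /h /mesh_size mulrCA mulfV ?mulr1 // gt_eqF.
have M0 : 0 <= M by apply: le_trans (FM 0%N 0 (leq0n _)).
pose s := h / 2.
have s0 : 0 < s by rewrite /s; lra.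
pose node := mesh_node a b N.
have nodeS i : node i.+1 = node i + 2 * s by rewrite /node /mesh_node -/h -natr1 /s; field.
have node_lt i : node i < node i.+1 by rewrite nodeS; lra.
(* Choice needs a polynomial for every index; beyond the last cell the zero polynomial is a
   placeholder. *)
have /choice[q Hq] : forall i, exists q : {poly R}, (i < N)%N ->
    (size q <= k.+1)%N /\ forall y, node i < y < node i.+1 -> w y = q.[y].
  move=> i; case: (ltnP i N) => [iN|_]; last by exists 0.
  have [q sq Eq] := wV i iN; exists q => _; split => // y yi.
  by apply: Eq; rewrite inE /mesh_cell /= ?in_itv.
have F0c : continuous (F 0%N) by move=> y; apply: (is_derive_continuous (dF 0%N _ y));
    rewrite addn3.
(* The chain rule supplies [s ^+ i]. The index [l] runs over all naturals: [F] is already periodic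
   on the line, whereas the polynomials of [w] exist on [N] cells only and are reindexed modulo [N]
   in [om]. *)
pose v l i y := s ^+ i * F i (node l + s * (y + 1)).
pose om l := q (l %% N)%N \Po affine (node (l %% N)%N) s.
have lN l : (l %% N < N)%N by rewrite ltn_mod.
have perF' i n y : (i <= k + 3)%N -> F i (y + n%:R * ell) = F i y.
  move=> ik; elim: n => [|n IH]; first by rewrite mul0r addr0.
  by rewrite -natr1 mulrDl mul1r addrA perF.
have nodemod l : node l = node (l %% N)%N + (l %/ N)%:R * ell.
  by rewrite /node /mesh_node -/h -Nh {1}(divn_eq l N) natrD natrM; ring.
have Fmod l i t : (i <= k + 3)%N -> F i (node l + t) = F i (node (l %% N)%N + t).
  by move=> ik; rewrite (nodemod l) addrAC perF'.
have vper l i y : (i <= 1)%N -> v (l + N)%N i y = v l i y.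
  move=> i1; have ik : (i <= k + 3)%N by rewrite (leq_trans i1) // addn3.
  by rewrite /v (Fmod (l + N)%N) // modnDr -Fmod.
have omper l : om (l + N)%N = om l by rewrite /om modnDr.
have dv l i : (i <= k)%N -> forall y : R, is_derive y 1 (v l i) (v l i.+1 y).
  move=> ik y; rewrite /v.
  have D1 : is_derive y 1 (F i \o (fun y => node l + s * (y + 1)))
      (F i.+1 (node l + s * (y + 1)) * s).
    apply: is_derive1_comp; first by apply: dF; rewrite addn3 ltnS (leq_trans ik) // !leqW.
    by apply: is_derive_eq; rewrite /GRing.scale /=; ring.
  have := is_deriveZ (s ^+ i) D1; congr (is_derive _ _ _ _).
  by rewrite /GRing.scale /= exprS; ring.
have som l : (size (om l) <= k.+1)%N.
  by apply: leq_trans (size_affine_comp _ _ _) _; have [] := Hq _ (lN l).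
have mom l (r : {poly R}) : (size r <= k.-1)%N ->
    \int[leb R]_(y in `[-1, 1]) ((v l 0%N y - (om l).[y]) * r.[y]) = 0.
  move=> sr; set l0 := (l %% N)%N; have l0N : (l0 < N)%N := lN l.
  have [sq wq] := Hq _ l0N.
  (* The inverse cell map, [y] to [(y - node l0) / s - 1], carries the reference test polynomial to
     the physical cell. *)
  pose r1 := r \Po affine (- (node l0 / s) - 1 - s^-1) s^-1.
  have r1E y : r1.[node l0 + s * (y + 1)] = r.[y].
    by rewrite horner_affine; congr (r.[_]); field; rewrite gt_eqF.
  have sr1 : (size r1 <= k.-1)%N by apply: leq_trans (size_affine_comp _ _ _) _.
  pose g y := (F 0%N y - (q l0).[y]) * r1.[y].
  have cg : continuous g.
    by apply: continuous_hornerM => y; apply: cvgB; [exact: F0c|exact: continuous_horner].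
  have := Rintegral_affine (node l0) cg s0; rewrite -nodeS.
  have -> : \int[leb R]_(y in `[node l0, node l0.+1]) g y = 0.
    have Ig := continuous_segment_integrable (node l0) (node l0.+1) cg.
    have cu : continuous (fun y => F 0%N y * r1.[y]) by exact: continuous_hornerM.
    have cq : continuous (fun y => (q l0).[y] * r1.[y]).
      by apply: continuous_hornerM; exact: continuous_horner.
    have oo (f : R -> R) : continuous f -> (leb R).-integrable `]node l0, node
        l0.+1[ (EFin \o f).
      move=> cf; apply: integrableS
          (continuous_segment_integrable (node l0) (node l0.+1) cf) => //.
      exact: subset_itv_oo_cc.
    have := wmom l0 l0N r1 sr1.
    have -> : \int[leb R]_(y in mesh_cell a b N l0) (w y * r1.[y]) =
        \int[leb R]_(y in `]node l0, node l0.+1[) ((q l0).[y] * r1.[y]).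
      apply: eq_Rintegral => y; rewrite inE /mesh_cell /= ?in_itv /= => yi.
      by rewrite wq.
    move=> E; rewrite /leb -Rintegral_itv_obnd_cbnd; last first.
      by apply: integrableS Ig => //; apply: subset_itvr; rewrite bnd_simp.
    rewrite -Rintegral_itv_bndo_bndc; last exact: oo.
    under eq_Rintegral do rewrite /g mulrBl.
    rewrite RintegralB //; [|exact: oo|exact: oo].
    by rewrite E subrr.
  move=> /eqP; rewrite mulf_eq0 gt_eqF //= => /eqP <-.
  apply: eq_Rintegral => y _; rewrite /g r1E /om horner_affine /v expr0 mul1r.
  by rewrite Fmod.
have trl (f : R -> R) (r : {poly R}) i : (forall y, node i < y < node i.+1 -> f y = r.[y])
    ->
    trace_left a b N f i.+1 = r.[node i.+1].
  by move=> fr; apply: (lim_at_left_eq (node_lt i) fr); exact: continuous_horner.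
have trr (f : R -> R) (r : {poly R}) i
    : (forall y, node (i %% N)%N < y < node (i %% N).+1 -> f y = r.[y]) ->
    trace_right a b N f i = r.[node (i %% N)%N].
  by move=> fr; apply: (lim_at_right_eq (node_lt (i %% N)%N) fr); exact: continuous_horner.
have ifc l :
    let Dm := v l 0%N 1 - (om l).[1] in
    let Dp := v l.+1 0%N (-1) - (om l.+1).[-1] in
    let Em := v l 1%N 1 - (om l)^`().[1] in
    let Ep := v l.+1 1%N (-1) - (om l.+1)^`().[-1] in
    (1 / 2 - al) * Dp + (1 / 2 + al) * Dm + be2 * (2 / h * (Ep - Em)) = 0 /\
    2 / h * ((1 / 2 + al) * Ep + (1 / 2 - al) * Em) + be1 * (Dp - Dm) = 0.
  set l0 := (l %% N)%N; set i := l0.+1.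
  have iN : (1 <= i <= N)%N by rewrite /i lN.
  (* Interfaces are numbered from 1 to [N]; at [i = N] the cell on the right is the first one. *)
  have lS : (l.+1 %% N)%N = (i %% N)%N by rewrite /i /l0 -addn1 -modnDml addn1.
  have [_ wq0] := Hq _ (lN l).
  have [_ wq1] := Hq _ (lN l.+1).
  have := wi1 i iN; have := wi2 i iN; rewrite /average /jump.
  rewrite (trl _ _ _ wq0) (trl _ _ _ (derive1_eq_poly wq0)).
  rewrite lS in wq1.
  rewrite (trr _ _ _ wq1) (trr _ _ _ (derive1_eq_poly wq1)).
  have -> : derive1 (F 0%N) (mesh_node a b N i) = F 1%N (node i).
    have D := dF 0%N (ltn_addl k (isT : (0 < 3)%N)) (node i).
    by rewrite derive1E (@derive_val _ _ _ _ _ _ _ D).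
  rewrite -[mesh_node a b N i]/(node i) -/l0.
  rewrite /om !horner_affine !horner_affine_deriv -/l0 lS /v.
  have -> : node l0 + s * (1 + 1) = node i by rewrite /i nodeS; ring.
  have -> : node (i %% N)%N + s * (-1 + 1) = node (i %% N)%N by ring.
  have Fe n : (n <= 1)%N -> F n (node l + s * (1 + 1))
      = F n (node i) /\ F n (node l.+1 + s * (-1 + 1)) = F n (node i).
    move=> n1; have nk : (n <= k + 3)%N by rewrite (leq_trans n1) // addn3.
    have e : F n (node l + s * (1 + 1)) = F n (node i).
      by rewrite Fmod // -/l0 /i nodeS; congr (F n _); ring.
    split=> //; rewrite -e; congr (F n _); rewrite nodeS; ring.
  have [-> ->] := Fe 0%N isT; have [-> ->] := Fe 1%N isT.
  rewrite !expr0 !expr1 !mul1r.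
  move: (F 0%N _) (F 1%N _) (q _).[_] (q _).[_] (q _)^`().[_] (q _)^`().[_].
  move=> U U1 wR wL dR dL E2 E1.
  by rewrite -E1 -E2 /s; split; field; rewrite gt_eqF.
have FMk i : (i <= 2)%N -> forall y, `|F (k.+1 + i)%N y| <= M.
  move=> i2 y; apply: FM; rewrite addSnnS leq_add2l //.
have sk0 : 0 <= s ^+ k.+1 by rewrite exprn_ge0 // ltW.
have nodeh l y : node l.+1 + s * (y + 1) = node l + s * (y + 1) + h.
  by rewrite nodeS /s; field.
have dk i : (i <= 1)%N -> forall y : R, is_derive y 1 (F (k.+1 + i)%N)
    (F (k.+1 + i.+1)%N y).
  by move=> i1 y; rewrite addnS; apply: dF; rewrite addSnnS ltn_add2l.
have b0 l y : -1 <= y <= 1 -> `|v l k.+1 y| <= s ^+ k.+1 * M.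
  move=> _; rewrite /v normrM ger0_norm // ler_wpM2l //.
  by have := FMk 0%N isT (node l + s * (y + 1)); rewrite addn0.
have b1 l y : -1 <= y <= 1 -> `|v l.+1 k.+1 y - v l k.+1 y| <= s ^+ k.+1 * (h * M).
  move=> _; rewrite /v nodeh -mulrBr normrM ger0_norm // ler_wpM2l //.
  have := difference_bound (ltW h0) (dk 0%N isT) (FMk 1%N isT).
  by rewrite addn0; apply.
have b2 l y : -1 <= y <= 1 ->
    `|(v l.+2 k.+1 y - v l.+1 k.+1 y) - (v l.+1 k.+1 y - v l k.+1 y)| <= s ^+ k.+1 *
        (h * (h * M)).
  move=> _; rewrite /v !nodeh -!mulrBr normrM ger0_norm // ler_wpM2l //.
  have := second_difference_bound (ltW h0) (dk 0%N isT) (dk 1%N isT) (FMk 2%N isT).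
  by rewrite addn0; apply.
have main := HC N h al be1 be2 v om _ _ _ h0 oN nd GL vper omper dv som mom ifc b0 b1 b2 j.
pose y := (x - node j) / s - 1.
have yI : -1 <= y <= 1.
  have sx : 0 < x - node j < 2 * s by move: xj; rewrite -/node nodeS; lra.
  have : 0 <= (x - node j) / s <= 2.
    rewrite divr_ge0 ?ler_pdivrMr //; lra.
  by rewrite /y; lra.
have xy : node j + s * (y + 1) = x by rewrite /y; field; rewrite gt_eqF.
have := main y yI.
have [_ wqj] := Hq _ jN.
rewrite /v /om modn_small // horner_affine xy expr0 mul1r -wqj // distrC => /le_trans;
    apply.
set qh := induced_norm _ / _; set n1 := `|V1 _ _ _ _ _|; set n2 := h^-1 * _.
have qh0 : 0 <= qh.
  by rewrite mulr_ge0 ?invr_ge0 //; have [] := induced_norm_le (Q2 k h al be1 be2) 0.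
have n10 : 0 <= n1 by exact: normr_ge0.
have n20 : 0 <= n2 by rewrite /n2 mulr_ge0 ?normr_ge0 // invr_ge0 ltW.
have sh : s ^+ k.+1 * M <= h ^+ k.+1 * M.
  by rewrite ler_wpM2r // lerXn2r ?nnegrE ?(ltW s0) ?(ltW h0) // /s; lra.
have sM0 : 0 <= s ^+ k.+1 * M by exact: mulr_ge0.
(* The powers of [N] meet the powers of [h] gained by the differences, and the three terms form the
   square of [1 + N * h = 1 + (b - a)]. *)
have -> : s ^+ k.+1 * M + 2 * N%:R * (s ^+ k.+1 * (h * M)) + N%:R ^+ 2 *
    (s ^+ k.+1 * (h * (h * M)))
    = s ^+ k.+1 * M * (1 + ell) ^+ 2 by rewrite -Nh; ring.
have B1 : 1 <= (1 + ell) ^+ 2 by rewrite exprn_ege1 //; lra.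
rewrite -(mulrA _ (h ^+ k.+1) M).
exact: absorb_constants.
Qed.

(** * From cells to the norm on [[a, b]] *)

Lemma mesh_cover (R : realType) (a b : R) (N n : nat) (x : R) : (n <= N)%N ->
  a <= x <= mesh_node a b N n ->
  x \notin [seq mesh_node a b N i | i <- iota 0 N.+1] ->
  exists2 j, (j < n)%N & mesh_node a b N j < x < mesh_node a b N j.+1.
Proof.
elim: n => [|n IH] nN /andP[ax xn] xnode.
  have E : mesh_node a b N 0 = a by rewrite /mesh_node mul0r addr0.
  rewrite E in xn; case/negP: xnode; apply/mapP; exists 0%N; first by rewrite mem_iota.
  by rewrite E; apply/eqP; rewrite eq_le xn ax.
case: (leP x (mesh_node a b N n)) => xle.
  have [|j jn xj] := IH (ltnW nN) _ xnode; first by rewrite ax.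
  by exists j => //; exact: leqW.
exists n => //; rewrite xle /= lt_neqAle xn andbT.
apply/eqP => E; case/negP: xnode; apply/mapP; exists n.+1 => //.
by rewrite mem_iota.
Qed.

(** Values at the nodes are unconstrained, so the interval is built up by adjoining one open cell
    and one single node at a time. *)
Lemma Vh_measurable (R : realType) (a b : R) (N k : nat) (w : R -> R) :
  a < b -> (0 < N)%N -> Vh a b N k w ->
  measurable_fun `[a, b] (w : measurableTypeR R -> R).
Proof.
move=> ab N0 wV; pose node := mesh_node a b N.
have h0 : 0 < mesh_size a b N by rewrite /mesh_size divr_gt0 ?ltr0n //; lra.
have node_lt i : node i < node i.+1.
  by rewrite /node /mesh_node -natr1 mulrDl mul1r; lra.
have node0 : node 0%N = a by rewrite /node /mesh_node mul0r addr0.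
have nodeN : node N = b.
  by rewrite /node /mesh_node /mesh_size mulrCA mulfV ?mulr1 ?pnatr_eq0 -?lt0n // addrC
      subrK.
have node_ge i : a <= node i by rewrite /node /mesh_node lerDl mulr_ge0 // ltW.
suff H n : (n <= N)%N -> measurable_fun `[a, node n] (w : measurableTypeR R -> R).
  by rewrite -nodeN; exact: H.
elim: n => [|n IH] nN.
  by rewrite node0 set_itv1; exact: measurable_fun_set1.
have -> : [set` `[a, node n.+1]] = [set` `[a, node n]] `|` [set` `]node n, node n.+1[] `|`
    [set node n.+1].
  apply/seteqP; split => y /=; rewrite !in_itv /=.
  - move=> /andP[ay yn]; case: (leP y (node n)) => yle; first by left; left; rewrite ay.
    case: (eqVneq y (node n.+1)) => [->|yne]; first by right.
    by left; right; rewrite lt_neqAle yne.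
  - have := node_lt n; have := node_ge n => ? ?.
    by case=> [[/andP[? ?]|/andP[? ?]]|->]; apply/andP; split; lra.
have mU : measurable ([set` `[a, node n]] `|` [set` `]node n, node n.+1[] : set
    (measurableTypeR R)).
  exact: measurableU.
apply/measurable_funU => //; split; last exact: measurable_fun_set1.
apply/measurable_funU => //; split; first exact: IH (ltnW nN).
have [q sq Eq] := wV n nN.
apply: (eq_measurable_fun (horner q)).
  by move=> y yn; rewrite Eq.
by apply: measurable_funTS; apply: continuous_measurable_fun; exact: continuous_horner.
Qed.

Theorem lemma3p8 (R : realType) (k : nat) (a b : R) (p : \bar R)
    (hk : (1 <= k)%N) (hab : a < b) (hp : p = 2%:E \/ p = +oo%E) :
  exists2 C : R, 0 < C &
  forall (N : nat) (alpha1 beta1 beta2 : R),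
    let h := mesh_size a b N in
    let Gamma := Gam k h alpha1 beta1 beta2 in
    let Lambda := Lam k h alpha1 beta1 beta2 in
    alpha1 ^+ 2 + beta1 * beta2 <> 1 / 4 ->
    `|Gamma| = `|Lambda| ->
    odd N ->
    Gamma = (if odd k then - Lambda else Lambda) ->
    forall u w : R -> R,
      periodic_Winfty (k + 4) a b u ->
      is_Phstar a b N k alpha1 beta1 beta2 u w ->
      (LpNorm p `[a, b] (w \- u)%R
       <= (C * h ^+ k.+1)%:E * WinftyNorm (k + 4) `[a, b] u
          * (1 + (1 + induced_norm (Q2 k h alpha1 beta1 beta2) / `|Gamma|)
               * (`|V1 k h alpha1 beta1 beta2|
                  + h^-1 * `|V2 k h|))%:E)%E.
Proof.
have [C C0 HC] := pointwise_error hk hab.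
have L0 : 0 < b - a by lra.
(* [1 + (b - a)] passes from the pointwise bound to the norm. The pointwise constant is only
   nonnegative; the added 1 makes the final one positive, which also serves when the Sobolev norm is
   infinite. *)
exists ((1 + (b - a)) * C + 1).
  by have : 0 <= (1 + (b - a)) * C; [rewrite mulr_ge0 //; lra|lra].
move=> N alpha1 beta1 beta2 h Gamma Lambda nd _ oN GL u w uW wP.
have N0 : (0 < N)%N by case: (N) oN.
have h0 : 0 < h by rewrite /h /mesh_size divr_gt0 // ltr0n.
set P := 1 + _ * _.
have P0 : 1 <= P.
  rewrite lerDl mulr_ge0 //.
    have [_ i0] := induced_norm_le (Q2 k h alpha1 beta1 beta2) 0.
    by rewrite addr_ge0 // mulr_ge0 ?invr_ge0.
  by rewrite addr_ge0 // mulr_ge0 // invr_ge0 ltW.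
have k4 : (k + 4 = (k + 3).+1)%N by rewrite !addnS.
have uW' := uW; rewrite k4 in uW'.
have [F [F0 Fc dF perF FM]] := periodic_Winfty_smooth hab uW'.
rewrite -k4 in FM.
set c := (_ * C + 1) * _.
have c0 : 0 < c.
  rewrite mulr_gt0 ?exprn_gt0 //.
  by have : 0 <= (1 + (b - a)) * C; [rewrite mulr_ge0 //; lra|lra].
(* The Sobolev norm is an extended real: minus infinity is excluded because it bounds an absolute
   value, and plus infinity makes the right-hand side infinite, its other factors being positive. *)
have := FM 0%N a (leq0n _); move: FM; case: (WinftyNorm _ _ _) => [M FM _| _ _ |]; last
    by [].
  have FM' i x : (i <= k + 3)%N -> `|F i x| <= M by move=> ik; have := FM i x ik;
      rewrite lee_fin.
  have M0 : 0 <= M by apply: le_trans (FM' 0%N a (leq0n _)).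
  rewrite -F0 in wP.
  have E := HC N alpha1 beta1 beta2 F w M oN nd GL dF perF FM' wP.
  rewrite F0 -/P -/h in E.
  set B := C * h ^+ k.+1 * M * P in E.
  have B0 : 0 <= B.
    apply: mulr_ge0; last exact: le_trans ler01 P0.
    by apply: mulr_ge0 => //; apply: mulr_ge0 => //; exact: exprn_ge0 (ltW h0).
  have mwu : measurable_fun `[a, b] ((w \- u)%R : measurableTypeR R -> R).
    have [_ cu _] := uW; have [wV _ _ _] := wP.
    apply: measurable_funB; first exact: Vh_measurable wV.
    by apply: measurable_funTS; exact: continuous_measurable_fun.
  have aeB : {ae leb R, forall x, a <= x <= b -> `|(w \- u)%R x| <= B}.
    (* The pointwise bound holds inside the cells only; the finitely many nodes form a null set. *)
    apply: (@filterS _ _ (ae_filter_ringOfSetsType (leb R)) _ _ _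
      (ae_cofinite [seq mesh_node a b N i | i <- iota 0 N.+1])) => x xn xI.
    have nodeN : mesh_node a b N N = b.
      by rewrite /mesh_node /mesh_size mulrCA mulfV ?mulr1 ?pnatr_eq0 -?lt0n // addrC subrK.
    rewrite -nodeN in xI.
    have [j jN xj] := mesh_cover (leqnn N) xI xn.
    exact: (E j x jN xj).
  apply: le_trans (LpNorm_le hab B0 hp mwu aeB) _.
  rewrite -!EFinM lee_fin /B /c.
  have hM : 0 <= h ^+ k.+1 * M * P.
    apply: mulr_ge0; last exact: le_trans ler01 P0.
    by apply: mulr_ge0 => //; exact: exprn_ge0 (ltW h0).
  have -> : ((1 + (b - a)) * C + 1) * h ^+ k.+1 * M * P =
    (1 + (b - a)) * (C * h ^+ k.+1 * M * P) + h ^+ k.+1 * M * P by ring.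
  by rewrite lerDl.
rewrite gt0_muley ?lte_fin // gt0_mulye ?leey // lte_fin.
exact: lt_le_trans P0.
Qed.
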